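(* Let $\{X_t\}$ be a Markov chain on a countable state space $\Sigma$ satisfying the Lyapunov assumption (stated in the context) with finite set $B$, and let $\epsilon,\alpha,\Delta\in(0,1)$. (a) For any state $i\in B$ such that $\pi_i<(1-\epsilon)\Delta/(1+\epsilon)$, with probability greater than $1-\alpha$, the total number of random walk steps used by $\mathrm{IteratedRefinement}(i,\epsilon,\alpha)$ before satisfying $\hat\pi_i^{(k)}<\Delta/(1+\epsilon)$ is bounded above by $$\tilde O\left(\frac{R_i\ln(1/\alpha)}{\epsilon^2}\ln\left(\pi_iR_i\left(1-\frac{\pi_i}{\Delta}\right)^{-1}\right)\right).$$ (b) For all states $i\in B$, with probability greater than $1-\alpha$, the total number of random walk steps used by $\mathrm{IteratedRefinement}(i,\epsilon,\alpha)$ before satisfying $\hat p^{(k)}<2\epsilon/3$ is bounded above by $$\tilde O\left(\frac{R_i\ln(1/\alpha)}{\epsilon^2}\right).$$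
   Context: Chain: $\{X_t\}_{t\ge0}$ is a discrete-time, positive recurrent Markov chain with unique stationary distribution $\pi$; $\mathbb P_i(\cdot)=\mathbb P(\cdot\mid X_0=i)$, $\mathbb E_i[\cdot]=\mathbb E[\cdot\mid X_0=i]$; $T_i=\inf\{t\ge1:X_t=i\}$. Lyapunov assumption: $\{X_t\}$ is irreducible and there exist $V:\Sigma\to\mathbb R_+$ and constants $\nu_{\max},\gamma>0$, $b\ge0$ such that (1) $B=\{x\in\Sigma:V(x)\le b\}$ is finite; (2) $|V(y)-V(x)|\le\nu_{\max}$ whenever $\mathbb P(X_{t+1}=y\mid X_t=x)>0$; (3) $\mathbb E[V(X_{t+1})-V(X_t)\mid X_t=x]<-\gamma$ for all $x$ with $V(x)>b$. Constant $R_i$ ($i\in B$): a positive constant for which $\mathbb P_i(T_i>k)\le4\cdot2^{-k/R_i}$ for all positive integers $k$, with $R_i=O\left(\frac{H_i^Be^{2\eta\nu_{\max}}}{(1-\rho)(e^{\eta\nu_{\max}}-\rho)}\right)$, where $\eta=\frac{\gamma}{2(e-2)\nu_{\max}^2}$, $\rho=1-\frac{\gamma^2}{4(e-2)\nu_{\max}^2}$, and $H_i^B=\max_{j\in B}\mathbb E_j[T_i^B]$ with $T_i^B=\inf\{t\ge1:Y_t=i\}$ for the chain $\{Y_t\}$ obtained by observing $\{X_t\}$ only at its successive visits to $B$. Algorithm $\mathrm{IteratedRefinement}(i,\epsilon,\alpha)$: iterations $k=1,2,\dots$ with truncation thresholds $\theta^{(k)}=2^k$ and sample sizes $N^{(1)}=\lceil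 6(1+\epsilon)\ln(8/\alpha)/\epsilon^2\rceil$, $N^{(k+1)}=\lceil 3(1+\epsilon)\theta^{(k+1)}\ln(4\theta^{(k+1)}/\alpha)/(\hat T_i^{(k)}\epsilon^2)\rceil$. In iteration $k$, $N^{(k)}$ fresh independent realizations of the chain started at $X_0=i$ are simulated, each stopped at the first time $t\ge1$ with $t=\theta^{(k)}$ or $X_t=i$; the $s$-th has length $t_s$ distributed as $\min(T_i,\theta^{(k)})$. Set $\hat T_i^{(k)}=\frac1{N^{(k)}}\sum_{s=1}^{N^{(k)}}t_s$, $\hat\pi_i^{(k)}=1/\hat T_i^{(k)}$, and let $\hat p^{(k)}$ be the fraction of the $N^{(k)}$ samples that are truncated (those with $T_i>\theta^{(k)}$). The number of random walk steps in iteration $k$ is $N^{(k)}\hat T_i^{(k)}$. Notation: $\tilde O(f(a)g(b))=O(f(a)\,\mathrm{polylog} f(a))\,O(g(b)\,\mathrm{polylog} g(b))$. *)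

(* Defs.v *)
From HB Require Import structures.
From mathcomp Require Import all_boot all_order all_algebra.
From mathcomp Require Import all_classical all_reals all_analysis.

Set Implicit Arguments.
Unset Strict Implicit.
Unset Printing Implicit Defensive.

Import Order.TTheory GRing.Theory Num.Theory.
Import numFieldNormedType.Exports.

Local Open Scope classical_set_scope.
Local Open Scope ring_scope.

Section Paths.
Context {R : realType} {S : countType}.
Implicit Types (x : nat -> S) (i y : S) (B : set S).

Definition return_time i x : \bar R :=
  ereal_inf [set t%:R%:E | t in [set t : nat | (1 <= t)%N /\ x t = i]].

Definition visits B x (t : nat) : nat := (\sum_(1 <= s < t.+1) (x s \in B))%N.

(* For a path with x 0 in B: Y_n = y, where Y is x observed only at its
   successive visits to B and Y_0 = x 0. *)
Definition observed_at B x (n : nat) y : Prop :=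
  exists t, [/\ x t \in B, visits B x t = n & x t = y].

Definition observed_return_time B i x : \bar R :=
  ereal_inf [set n%:R%:E | n in [set n : nat | (1 <= n)%N /\ observed_at B x n i]].

End Paths.

Section Chains.
Context {R : realType} {S : countType}.

Definition stochastic (Q : S -> S -> R) : Prop :=
  (forall x y, 0 <= Q x y) /\
  (forall x, (\esum_(y in [set: S]) (Q x y)%:E = 1)%E).

Definition stationary (Q : S -> S -> R) (pi : S -> R) : Prop :=
  [/\ forall x, 0 <= pi x,
      (\esum_(x in [set: S]) (pi x)%:E = 1)%E &
      forall y, (\esum_(x in [set: S]) (pi x * Q x y)%:E = (pi y)%:E)%E].

Definition unique_stationary (Q : S -> S -> R) (pi : S -> R) : Prop :=
  stationary Q pi /\ forall pi', stationary Q pi' -> pi' =1 pi.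

(* The last clause is the Markov property, multiplied out so that it makes
   sense when the conditioning event is null. *)
Definition markov_chain {d} {Omega : measurableType d}
    (P : probability Omega R) (Q : S -> S -> R) (x0 : S)
    (X : nat -> Omega -> S) : Prop :=
  [/\ forall t x, measurable [set w | X t w = x],
      (P [set w | X 0%N w = x0] = 1)%E &
      forall (n : nat) (x : nat -> S),
        (P [set w | forall t, (t <= n.+1)%N -> X t w = x t] =
         P [set w | forall t, (t <= n)%N -> X t w = x t]
         * (Q (x n) (x n.+1))%:E)%E].

(* [Pr x] plays the role of the law P(. | X_0 = x). *)
Definition markov_family {d} {Omega : measurableType d}
    (Pr : S -> probability Omega R) (Q : S -> S -> R)
    (X : nat -> Omega -> S) : Prop :=
  stochastic Q /\ forall x, markov_chain (Pr x) Q x X.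

Definition irreducible {d} {Omega : measurableType d}
    (Pr : S -> probability Omega R) (X : nat -> Omega -> S) : Prop :=
  forall x y, exists n, (0 < Pr x [set w | X n w = y])%E.

Definition positive_recurrent {d} {Omega : measurableType d}
    (Pr : S -> probability Omega R) (X : nat -> Omega -> S) : Prop :=
  forall i, (\int[Pr i]_w return_time i (X ^~ w) < +oo)%E.

Definition sublevel (V : S -> R) (b : R) : set S := [set x | V x <= b].

Definition lyapunov {d} {Omega : measurableType d}
    (Pr : S -> probability Omega R) (Q : S -> S -> R) (X : nat -> Omega -> S)
    (V : S -> R) (numax gamma b : R) : Prop :=
  [/\ [/\ irreducible Pr X, forall x, 0 <= V x, 0 < numax, 0 < gamma & 0 <= b],
      finite_set (sublevel V b),
      forall x y, 0 < Q x y -> `|V y - V x| <= numax &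
      forall x, b < V x ->
        (\int[Pr x]_w (V (X 1%N w) - V (X 0%N w))%:E < (- gamma)%:E)%E].

(* The supremum is the maximum over the finite set B. *)
Definition max_observed_hitting {d} {Omega : measurableType d}
    (Pr : S -> probability Omega R) (X : nat -> Omega -> S)
    (B : set S) (i : S) : \bar R :=
  ereal_sup [set (\int[Pr j]_w observed_return_time B i (X ^~ w))%E | j in B].

Definition drift_eta (numax gamma : R) : R :=
  gamma / (2 * (expR 1 - 2) * numax ^+ 2).

Definition drift_rho (numax gamma : R) : R :=
  1 - gamma ^+ 2 / (4 * (expR 1 - 2) * numax ^+ 2).

(* K is the constant hidden in the O(.) that bounds the tail constant r. *)
Definition return_tail_constant {d} {Omega : measurableType d}
    (Pr : S -> probability Omega R) (X : nat -> Omega -> S)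
    (B : set S) (numax gamma K : R) (i : S) (r : R) : Prop :=
  let eta := drift_eta numax gamma in
  let rho := drift_rho numax gamma in
  [/\ 0 < r,
      forall k : nat, (1 <= k)%N ->
        (Pr i [set w | (k%:R)%:E < return_time i (X ^~ w) :> \bar R]
         <= (4 * 2 `^ (- (k%:R / r)))%:E)%E &
      (r%:E <= (K * (expR (2 * eta * numax)
                     / ((1 - rho) * (expR (eta * numax) - rho))))%:E
               * max_observed_hitting Pr X B i)%E].

Definition sigma_of_process {d} {Omega : measurableType d}
    (X : nat -> Omega -> S) : set (set Omega) :=
  <<s [set A | exists t x, A = [set w | X t w = x]] >>.

Definition independent_processes {d} {Omega : measurableType d} {I : choiceType}
    (P : probability Omega R) (X : I -> nat -> Omega -> S) : Prop :=
  forall (J : seq I) (A : I -> set Omega), uniq J ->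
    (forall j, j \in J -> sigma_of_process (X j) (A j)) ->
    (P (\bigcap_(j in [set` J]) A j) = \prod_(j <- J) P (A j))%E.

(* [Z k s] is the s-th realization available to iteration k; iteration k uses
   those with s < N^(k).  Drawing row k from a family that is independent of
   all other rows is what makes the realizations fresh although N^(k) is
   random. *)
Definition fresh_realizations {d} {Omega : measurableType d}
    (P : probability Omega R) (Q : S -> S -> R) (i : S)
    (Z : nat -> nat -> nat -> Omega -> S) : Prop :=
  (forall k s, markov_chain P Q i (Z k s)) /\
  independent_processes P (fun ks : nat * nat => Z ks.1 ks.2).

End Chains.

Section IteratedRefinement.
Context {R : realType} {S : countType}.
Context (i : S) (eps alpha : R).
(* [z k s t] is the state at time t of the s-th realization (s = 0, 1, ..) of
   iteration k; iterations are numbered from 1 and index 0 is unused. *)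
Context (z : nat -> nat -> nat -> S).

Definition threshold (k : nat) : nat := (2 ^ k)%N.

(* Least t in {1, .., theta} with t = theta or x t = i. *)
Definition walk_length (theta : nat) (x : nat -> S) : nat :=
  (find (fun t => (t == theta) || (x t == i)) (iota 1 theta)).+1.

Definition truncated (theta : nat) (x : nat -> S) : bool :=
  ((theta%:R)%:E < return_time i x :> \bar R)%E.

Definition mean_length (k N : nat) : R :=
  (\sum_(s < N) (walk_length (threshold k) (z k s))%:R) / N%:R.

Definition nceil (y : R) : nat := `|Num.ceil y|%N.

Fixpoint sample_size (k : nat) : nat :=
  match k with
  | 0 => 0
  | k'.+1 =>
    if k' == 0%N then nceil (6 * (1 + eps) * ln (8 / alpha) / eps ^+ 2)
    else nceil (3 * (1 + eps) * (threshold k)%:R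
                * ln (4 * (threshold k)%:R / alpha)
                / (mean_length k' (sample_size k') * eps ^+ 2))
  end.

Definition T_hat (k : nat) : R := mean_length k (sample_size k).

Definition pi_hat (k : nat) : R := 1 / T_hat k.

Definition p_hat (k : nat) : R :=
  (\sum_(s < sample_size k) (truncated (threshold k) (z k s))%:R)
  / (sample_size k)%:R.

Definition steps (k : nat) : R := (sample_size k)%:R * T_hat k.

(* Some iteration satisfies [stop], and at most [bound] steps are used up to
   and including the first such iteration. *)
Definition stops_within (stop : nat -> Prop) (bound : R) : Prop :=
  exists K : nat, [/\ (1 <= K)%N, stop K,
    forall k, (1 <= k < K)%N -> ~ stop k &
    \sum_(1 <= k < K.+1) steps k <= bound].

End IteratedRefinement.

(* One factor f polylog(f) of a soft-O bound.  Replacing f by max(1, f) gives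
   the bound a meaning for all parameter values: outside the asymptotic regime
   a factor such as ln (1/alpha) tends to 0, or a logarithm is negative.  Where
   f >= 1 it is f itself. *)
Definition soft {R : realType} (d : nat) (f : R) : R :=
  Num.max 1 f * (1 + ln (Num.max 1 f)) ^+ d.

(* Main.v *)
(** Let T be the return time to i and theta_k = 2^k.  Since the length sampled in
    iteration k is min(T, theta_k), Chernoff's bounds for [0, theta_k]-valued
    variables, applied conditionally on the earlier iterations (which determine
    the sample size), show that with probability at least 1 - alpha/2 every
    estimate T_hat lies between (1 - 5 eps/6) mu_k and (1 + eps) mu_k, where
    mu_k = E min(T, theta_k).  The factor 5/6 < 1 is what keeps the cost bounded
    as eps tends to 1, and leaves room in part (a) for the truncation bias.

    By the last-visit decomposition of the stationary chain,
    pi_i mu_k = 1 - P_pi(no visit to i before time theta_k), and irreducibility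
    makes the last probability vanish in the limit; with the tail bound this
    gives 1 - pi_i mu_k <= 16 r 2^(-theta_k / r), r = max(1, R_i).  Hence both
    stopping rules are met as soon as theta_k is of order
    r (1 + ln r) (1 + ln(1/eps)), and the cost is dominated by the last
    iteration.  Since pi_i <= 1, the logarithmic factor of (a) is absorbed by the
    polylogarithms of R_i and 1/eps. *)

Require Import Defs.
From HB Require Import structures.
From mathcomp Require Import all_boot all_order all_algebra.
From mathcomp Require Import all_classical all_reals all_analysis.
From mathcomp Require Import zify ring lra.

Set Implicit Arguments.
Unset Strict Implicit.
Unset Printing Implicit Defensive.

Import Order.TTheory GRing.Theory Num.Theory.
Import numFieldNormedType.Exports.

Local Open Scope classical_set_scope.
Local Open Scope ring_scope.

(** * Numerical bounds for exp and ln *)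

Section ExpBounds.
Context {R : realType}.
Implicit Types x y : R.

Lemma derive_ge0_le (f df : R -> R) (b : R) : 0 <= b ->
  (forall x, is_derive x 1 f (df x)) -> (forall x, 0 <= x <= b -> 0 <= df x) -> f 0 <= f b.
Proof.
move=> b0 fdf df0.
have cf : {within `[0, b], continuous f}.
  by apply: derivable_within_continuous => x _; have [] := fdf x.
have [c] := @MVT_segment R f df 0 b b0 (fun x _ => fdf x) cf.
rewrite in_itv /= => /df0 c0 h; rewrite -subr_ge0 h mulr_ge0// subr_ge0//.
Qed.

(** Multiplied by [expR (- y)], the right side has derivative
    [expR (- y) * (y / 2 - 3 / 4 * y ^+ 2)], which for y >= 0 is nonnegative exactly up to y = 2/3.
    Serves the upper Chernoff tail. *)
Lemma expR_upper x : 0 <= x <= 2 / 3 -> expR x <= 1 + x + 3 / 4 * x ^+ 2.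
Proof.
move=> /andP[x0 x1].
pose f (y : R) := expR (- y) * (1 + y + 3 / 4 * y ^+ 2).
have h : f 0 <= f x.
  apply: (@derive_ge0_le f (fun y => expR (- y) * (y / 2 - 3 / 4 * y ^+ 2))) => //.
    by move=> y; apply: is_derive_eq; rewrite /GRing.scale /=; field.
  by move=> y /andP[y0 yx]; rewrite mulr_ge0 ?expR_ge0//; nra.
move: h; rewrite /f oppr0 expR0 expRN mulrC expr0n /= mulr0 !addr0 mul1r.
by rewrite ler_pdivlMl ?expR_gt0// mulr1.
Qed.

(** The product [expR y * (1 - y + y ^+ 2 / 2)] has derivative [expR y * (y ^+ 2 / 2) >= 0]. Serves
    the lower Chernoff tail. *)
Lemma expRN_upper x : 0 <= x -> expR (- x) <= 1 - x + x ^+ 2 / 2.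
Proof.
move=> x0.
pose f (y : R) := expR y * (1 - y + y ^+ 2 / 2).
have h : f 0 <= f x.
  apply: (@derive_ge0_le f (fun y => expR y * (y ^+ 2 / 2))) => //.
    by move=> y; apply: is_derive_eq; rewrite /GRing.scale /=; field.
  by move=> y _; rewrite mulr_ge0 ?expR_ge0// divr_ge0// sqr_ge0.
move: h; rewrite /f expR0 mul1r subr0 expr0n /= mul0r addr0.
by rewrite expRN mulrC -ler_pdivrMr ?expR_gt0// mul1r.
Qed.

Lemma expR_half_le2 : expR (1 / 2) <= 2 :> R.
Proof.
have := expR_ge1Dx (- (1 / 2) : R); rewrite expRN => h.
have e0 := expR_gt0 (1 / 2 : R).
have := ler_wpM2r (ltW e0) h; rewrite mulVf ?gt_eqF//; lra.
Qed.

Lemma expR1_le4 : expR 1 <= 4 :> R.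
Proof.
have -> : (1 : R) = 1 / 2 + 1 / 2 by lra.
rewrite expRD; have := expR_half_le2; have := expR_gt0 (1 / 2 : R); nra.
Qed.

Lemma ln2_ge_half : 1 / 2 <= ln 2 :> R.
Proof. by rewrite -[1 / 2](@expRK R) ler_ln ?posrE ?expR_gt0//; exact: expR_half_le2. Qed.
End ExpBounds.

(** * Laws of Markov chains *)

Section Esum.
Local Open Scope ereal_scope.
Context {R : realType}.

Lemma esumZl (T : choiceType) (I : set T) (c : R) (a : T -> \bar R) :
  (0 <= c)%R -> (forall x, 0 <= a x) ->
  \esum_(x in I) (c%:E * a x) = c%:E * \esum_(x in I) a x.
Proof.
move=> c0 a0; rewrite /esum -ereal_supZl//; last first.
  by apply/set0P; exists 0; exists set0; [exact: fsets_set0|rewrite fsbig_set0].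
congr ereal_sup; apply/seteqP; split => [_ [X [fX XI] <-]|_ [_ [X [fX XI] <-] <-]].
- by exists (\sum_(x \in X) a x); [exists X|rewrite ge0_mule_fsumr].
- by exists X => //; rewrite ge0_mule_fsumr.
Qed.

Lemma exchange_esum (T1 T2 : choiceType) (I : set T1) (J : set T2)
    (a : T1 -> T2 -> \bar R) : (forall x y, 0 <= a x y) ->
  \esum_(x in I) \esum_(y in J) a x y = \esum_(y in J) \esum_(x in I) a x y.
Proof.
move=> a0; rewrite !esum_esum//.
rewrite (@reindex_esum _ _ _ (J `*`` fun=> I) _ (fun p => (p.2, p.1)))//.
split => [[y x] [] //|[y x] [y' x'] _ _ [-> ->] //|[x y] [/= Ix Jy]].
by exists (y, x).
Qed.

Lemma measure_bigcup_countType d (T : measurableType d) (mu : {measure set T -> \bar R})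
    (S : countType) (D : set S) (F : S -> set T) :
  (forall y, D y -> measurable (F y)) -> trivIset D F ->
  mu (\bigcup_(y in D) F y) = \esum_(y in D) mu (F y).
Proof.
move=> mF tF.
(* Transport along [pickle] to a family indexed by naturals, empty at numbers that code no
   element. *)
pose G n := if @unpickle S n is Some y then F y else set0.
have GE y : G (pickle y) = F y by rewrite /G pickleK.
have -> : \bigcup_(y in D) F y = \bigcup_(n in pickle @` D) G n.
  apply/seteqP; split => [w [y Dy Fy]|w [_ [y Dy <-]]]; last first.
    by rewrite GE; exists y.
  by exists (pickle y); [exists y|rewrite GE].
rewrite measure_bigcup; first last.
- move=> _ _ [y Dy <-] [y' Dy' <-]; rewrite !GE => /(tF _ _ Dy Dy') ->//.
- by move=> _ [y Dy <-]; rewrite GE; exact: mF.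
rewrite nneseries_esum// set_mem_set esum_image.
  by apply: eq_esum => y _; rewrite GE.
by move=> x y _ _; exact: (pcan_inj pickleK).
Qed.
End Esum.

Section Avoidance.
Local Open Scope ereal_scope.
Context {R : realType} {S : countType} (Q : S -> S -> R).
Hypothesis sQ : stochastic Q.

(* The probability that the chain started at [y] is in the k-th set of [As] at
   time k.+1, for all k < size As. *)
Fixpoint pass_prob (As : seq (set S)) (y : S) : \bar R :=
  if As is A :: As' then \esum_(z in A) ((Q y z)%:E * pass_prob As' z) else 1.

Let Q0 x y : (0 <= Q x y)%R. Proof. by case: sQ. Qed.

Lemma pass_prob_ge0 As y : 0 <= pass_prob As y.
Proof.
elim: As y => //= A As IH y; apply: esum_ge0 => z _.
by rewrite mule_ge0// lee_fin.
Qed.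

Lemma pass_prob_le1 As y : pass_prob As y <= 1.
Proof.
elim: As y => //= A As IH y; case: sQ => _ /(_ y) <-.
rewrite [leLHS]esum_mkcond; apply: le_esum => z _; case: ifP => _; rewrite ?lee_fin//.
by rewrite -[leRHS]mule1 lee_pmul// ?lee_fin// pass_prob_ge0.
Qed.

Context {d : measure_display} {Omega : measurableType d}.
Context (P : probability Omega R) (x0 : S) (X : nat -> Omega -> S).
Hypothesis mc : markov_chain P Q x0 X.

Let prefix n (x : nat -> S) := [set w | forall t, (t <= n)%N -> X t w = x t].

Lemma measurable_prefix n x : measurable (prefix n x).
Proof.
have -> : prefix n x = \bigcap_(t in `I_n.+1) [set w | X t w = x t].
  by apply/seteqP; split => w h t; exact: h.
by apply: fin_bigcap_measurable => // t _; case: mc.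
Qed.

Let passing n (As : seq (set S)) :=
  [set w | forall j, (j < size As)%N -> nth setT As j (X (n + j)%N w)].

Lemma measurable_in t (A : set S) : measurable [set w | A (X t w)].
Proof.
have -> : [set w | A (X t w)] = \bigcup_(y in setT) (if y \in A then [set w | X t w = y] else set0).
  apply/seteqP; split => [w Aw|w [y _]].
    by exists (X t w) => //; rewrite mem_set.
  by case: ifPn => // /set_mem Ay /= ->.
apply: countable_bigcupT_measurable; first exact: countableP.
by move=> y; case: ifP => // _; case: mc.
Qed.

Lemma measurable_passing n As : measurable (passing n As).
Proof.
have -> : passing n As = \bigcap_(j in `I_(size As)) [set w | nth setT As j (X (n + j)%N w)].
  by apply/seteqP; split => w h t; exact: h.
by apply: fin_bigcap_measurable => // t _; exact: measurable_in.
Qed.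

(** Split on the value z of the chain at time n + 1: z is absorbed into the prefix, the induction
    hypothesis treats the longer prefix, and the Markov clause supplies the factor [Q (x n) z]. *)
Lemma prob_prefix_pass n x As :
  P (prefix n x `&` passing n.+1 As) = P (prefix n x) * pass_prob As (x n).
Proof.
elim: As n x => [|A As IH] n x /=.
  by rewrite mule1; congr (P _); apply/seteqP; split => [w []|w].
pose x' z t := if (t <= n)%N then x t else z.
have prefixE z : prefix n.+1 (x' z) = prefix n x `&` [set w | X n.+1 w = z].
  apply/seteqP; split => [w h|w [h hz] t].
    split => [t tn|]; first by rewrite h /x' ?tn// leqW.
    by rewrite /= h// /x' ltnn.
  rewrite leq_eqVlt ltnS /x' => /orP[/eqP ->|tn]; first by rewrite ltnn.
  by rewrite tn h.
have -> : prefix n x `&` passing n.+1 (A :: As) =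
    \bigcup_(z in A) (prefix n.+1 (x' z) `&` passing n.+2 As).
  apply/seteqP; split => [w [h k]|w [z Az]].
    exists (X n.+1 w); first by have := k 0%N isT; rewrite addn0.
    split; first by rewrite prefixE.
    by move=> j jA; rewrite addSnnS; exact: (k j.+1).
  rewrite prefixE => -[[h hz] k]; split => // -[_|j jA] /=.
    by rewrite addn0 hz.
  by rewrite -addSnnS; exact: k.
rewrite measure_bigcup_countType; first last.
- by move=> z z' _ _ [w []]; rewrite !prefixE => -[[_ <-] _] [[_ <-] _].
- by move=> z _; apply: measurableI; [exact: measurable_prefix|exact: measurable_passing].
rewrite -[P (prefix n x)]fineK ?fin_num_measure//; last exact: measurable_prefix.
rewrite -esumZl ?fine_ge0//; last by move=> z; rewrite mule_ge0 ?lee_fin ?pass_prob_ge0.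
apply: eq_esum => z Az; apply: (eq_trans (IH _ _)); rewrite fineK ?fin_num_measure//;
  last exact: measurable_prefix.
rewrite muleA; congr (_ * _); last by rewrite /x' ltnn.
case: mc => _ _ /(_ n (x' z)); rewrite /x' leqnn ltnn => ->; congr (P _ * _).
by apply/seteqP; split => w h t tn; have := h t tn; rewrite tn.
Qed.

(** The chain starts at [x0] only almost surely, so the part of the event outside the prefix of
    length 0 is discarded as null. *)
Lemma prob_pass As : P (passing 1 As) = pass_prob As x0.
Proof.
have p0 : P (prefix 0 (fun=> x0)) = 1.
  case: mc => _ <- _; congr (P _); apply/seteqP; split => [w /(_ 0%N)|w h t].
    exact.
  by rewrite leqn0 => /eqP ->.
have := prob_prefix_pass 0 (fun=> x0) As; rewrite p0 mul1e => <-.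
have mp := measurable_prefix 0 (fun=> x0); have mq := measurable_passing 1 As.
rewrite -[in LHS](setIT (passing 1 As)) -(setUv (prefix 0 (fun=> x0))) setIUr measureU//.
- rewrite [X in _ + X](_ : _ = 0) ?adde0 1?setIC//.
  apply/eqP; rewrite eq_le measure_ge0 andbT.
  have <- : P (~` prefix 0 (fun=> x0)) = 0 by rewrite probability_setC// p0 subee.
  by apply: le_measure; rewrite ?inE//; [apply: measurableI => //; exact: measurableC|exact: measurableC].
- exact: measurableI.
- by apply: measurableI => //; exact: measurableC.
- by rewrite -setIIr setICr setI0.
Qed.
End Avoidance.

(** * Kac's formula *)

Section Kac.
Local Open Scope ereal_scope.
Context {R : realType} {S : countType} (Q : S -> S -> R) (i : S).
Hypothesis sQ : stochastic Q.

(** This is P_x(T_i > n). Being a function of the kernel alone, it links the realizations simulated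
    under [P] to the chain under [Pr]. *)
Definition avoid_prob n x : \bar R := pass_prob Q (nseq n [set~ i]) x.

(* The expectation of min(T_i, n). *)
Definition mean_return n : R := (\sum_(j < n) fine (avoid_prob j i))%R.

Let Q0 x y : (0 <= Q x y)%R. Proof. by case: sQ. Qed.

Lemma avoid_prob_ge0 n x : 0 <= avoid_prob n x.
Proof. exact: pass_prob_ge0. Qed.

Lemma avoid_prob_le1 n x : avoid_prob n x <= 1.
Proof. exact: pass_prob_le1. Qed.

Lemma avoid_prob_fin n x : avoid_prob n x \is a fin_num.
Proof.
by rewrite ge0_fin_numE ?avoid_prob_ge0// (le_lt_trans (avoid_prob_le1 _ _))// ltry.
Qed.

Lemma avoid_probS n x : avoid_prob n.+1 x <= avoid_prob n x.
Proof.
elim: n x => [|n IH] x; first exact: avoid_prob_le1.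
apply: le_esum => z _; rewrite lee_pmul ?lee_fin//; last exact: IH.
exact: (avoid_prob_ge0 n.+1 z).
Qed.

Lemma le_avoid_prob m n x : (m <= n)%N -> avoid_prob n x <= avoid_prob m x.
Proof.
by move=> /subnK <-; elim: (n - m)%N => // k; apply: le_trans; exact: avoid_probS.
Qed.

Lemma avoid_prob_step n x y : y != i ->
  (Q x y)%:E * avoid_prob n y <= avoid_prob n.+1 x.
Proof.
move=> yi; have <- : \esum_(z in [set y]) ((Q x z)%:E * avoid_prob n z) =
    (Q x y)%:E * avoid_prob n y.
  by rewrite esum_set1// mule_ge0 ?lee_fin// avoid_prob_ge0.
rewrite /avoid_prob /= [leLHS]esum_mkcond [leRHS]esum_mkcond.
apply: le_esum => z _; case: ifPn => [/set_mem ->|_].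
  by rewrite mem_set//=; exact/eqP.
by case: ifP => // _; rewrite mule_ge0 ?lee_fin// avoid_prob_ge0.
Qed.

(* Almost sure return to [i] from [x], expressed without limits. *)
Definition recurs x := forall e : R, (0 < e)%R -> exists n, avoid_prob n x <= e%:E.

(** The terms of [mean_return n] decrease, so [n * avoid_prob n i <= M]; any n > M / e will do. *)
Lemma recurs_self (M : R) : (forall n, mean_return n <= M)%R -> recurs i.
Proof.
move=> hM e e0; have M0 : (0 <= M)%R.
  by apply: le_trans (hM 0%N); rewrite /mean_return big_ord0.
pose n := (Num.truncn (M / e)).+1.
have nM : (M / e < n%:R)%R by exact: Num.Theory.truncnS_gt.
exists n; rewrite -[avoid_prob n i]fineK ?avoid_prob_fin// lee_fin.
have h : (n%:R * fine (avoid_prob n i) <= M)%R.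
  apply: le_trans (hM n); rewrite /mean_return mulr_natl -[X in (_ *+ X)%R]card_ord.
  rewrite -sumr_const; apply: ler_sum => j _.
  by apply: fine_le; rewrite ?avoid_prob_fin// le_avoid_prob// ltnW.
have n0 : (0 < n%:R :> R)%R by rewrite ltr0n.
rewrite -(ler_pM2l n0); apply: (le_trans h); rewrite -ler_pdivrMr//.
exact: ltW.
Qed.

(** One step to y followed by avoidance from y is a way to avoid i from x; hence avoidance from y
    costs at most a factor [1 / Q x y], and accuracy [Q x y * e] at x is enough. *)
Lemma recurs_step x y : recurs i -> recurs x -> (0 < Q x y)%R -> recurs y.
Proof.
move=> ri rx Qxy e e0; have [->|yi] := eqVneq y i; first exact: ri.
have [n hn] := rx (Q x y * e)%R (mulr_gt0 Qxy e0); exists n.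
have := le_trans (avoid_prob_step n x yi) (le_trans (avoid_probS n x) hn).
by rewrite EFinM lee_pmul2l// lte_fin.
Qed.

(** A positive sum has a positive term, so some first step z has positive probability and still
    leads to y; recurrence is carried along the path. *)
Lemma recurs_reachable n x y : recurs i -> recurs x ->
  0 < pass_prob Q (rcons (nseq n setT) [set y]) x -> recurs y.
Proof.
move=> ri; elim: n x => [|n IH] x rx /=.
  rewrite esum_set1 ?mule_ge0 ?lee_fin// mule1 lte_fin; exact: recurs_step.
move=> h; have [z [Qxz pz]] : exists z, (0 < Q x z)%R /\
    0 < pass_prob Q (rcons (nseq n setT) [set y]) z.
  apply: contrapT => H; suff : 0 < 0 :> \bar R by rewrite ltxx.
  rewrite (lt_le_trans h)// esum1// => z _.
  have := Q0 x z; rewrite le_eqVlt => /orP[/eqP <-|Qz]; first by rewrite mul0e.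
  have := pass_prob_ge0 sQ (rcons (nseq n setT) [set y]) z.
  rewrite le_eqVlt => /orP[/eqP <-|pz]; first by rewrite mule0.
  by case: H; exists z.
exact: (IH z (recurs_step ri rx Qxz)).
Qed.

Context (pi : S -> R).
Hypothesis st : stationary Q pi.

Let pi0 x : (0 <= pi x)%R. Proof. by case: st. Qed.

(** The probability that the stationary chain avoids i at all times 0, .., n. *)
Let escape n := \esum_(x in [set~ i]) ((pi x)%:E * avoid_prob n x).

(** By stationarity, avoiding i at times 0..n is as likely as avoiding it at times 1..n+1; the
    latter is then split by whether the chain starts at i. *)
Let escape_step n :
  escape n = (pi i)%:E * avoid_prob n.+1 i + escape n.+1.
Proof.
have a0 m x : 0 <= (pi x)%:E * avoid_prob m x.
  by rewrite mule_ge0 ?lee_fin// avoid_prob_ge0.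
transitivity (\esum_(x in [set: S]) ((pi x)%:E * avoid_prob n.+1 x)); last first.
  rewrite (esumID [set i])//; congr (_ + _); rewrite setTI//.
  by rewrite esum_set1.
rewrite /avoid_prob /=; under [RHS]eq_esum => x _.
  rewrite -esumZl//; last first.
    by move=> z; rewrite mule_ge0 ?lee_fin// pass_prob_ge0.
  over.
rewrite exchange_esum; last first.
  by move=> x y; rewrite !mule_ge0 ?lee_fin// pass_prob_ge0.
apply: eq_esum => y _; case: st => _ _ /(_ y) <-.
rewrite muleC -[avoid_prob n y]fineK ?avoid_prob_fin// -esumZl ?fine_ge0 ?avoid_prob_ge0//.
  apply: eq_esum => x _; rewrite fineK ?avoid_prob_fin// EFinM.
  by rewrite [RHS]muleA muleC.
by move=> x; rewrite lee_fin mulr_ge0.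
Qed.

(* Split on the last visit to [i] before time n, starting from [pi]. *)
Let kac_identity n : (pi i * mean_return n.+1)%:E + escape n = 1.
Proof.
elim: n => [|n <-].
  rewrite /mean_return big_ord_recl big_ord0 addr0 /= mulr1.
  case: st => _ <- _; rewrite [RHS](esumID [set i]) ?setTI//.
    rewrite esum_set1 ?lee_fin//; congr (_ + _).
    by apply: eq_esum => x _; rewrite mule1.
  by move=> x _; rewrite lee_fin.
rewrite [in RHS]escape_step addeA; congr (_ + _).
rewrite [in LHS]/mean_return big_ord_recr /= mulrDr EFinD; congr (_ + _).
by rewrite EFinM fineK// avoid_prob_fin.
Qed.

(** A finite set F carries all but e/2 of the mass of [pi], and finitely many recurrence times have
    a common maximum n. From then on the states of F contribute at most e/2, and the others at most
    their mass. *)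
Let escape_vanishes (e : R) : (forall x, recurs x) -> (0 < e)%R ->
  exists n, forall m, (n <= m)%N -> escape m <= e%:E.
Proof.
move=> rec e0; have e20 : (0 < e / 2)%R by rewrite divr_gt0.
have [F [finF _] hF] : exists2 F, fsets [set: S] F & (1 - (e / 2)%R%:E) < \sum_(x \in F) (pi x)%:E.
  case: st => _ pi1 _.
  have : 1 - (e / 2)%:E < \esum_(x in [set: S]) (pi x)%:E.
    by rewrite pi1 -EFinB lte_fin; lra.
  by move=> /ereal_sup_gt [_ [F fF <-]]; exists F.
have [n hn] : exists n, forall x, F x -> avoid_prob n x <= (e / 2)%:E.
  have /finite_seqP[s ->] := finF.
  elim: s => [|x s [n IH]]; first by exists 0%N.
  have [k hk] := rec x _ e20; exists (maxn k n) => y /=; rewrite inE.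
  move=> /orP[/eqP ->|/IH]; apply: le_trans; last exact: le_avoid_prob (leq_maxr _ _).
    exact: le_avoid_prob (leq_maxl _ _).
  by [].
exists n => m nm.
have a0 x : 0 <= (pi x)%:E * avoid_prob m x.
  by rewrite mule_ge0 ?lee_fin// avoid_prob_ge0.
have piF : \esum_(x in F) (pi x)%:E + \esum_(x in ~` F) (pi x)%:E = 1.
  case: st => _ <- _; rewrite [RHS](esumID F) ?setTI// => x _.
  by rewrite lee_fin.
have sF0 : 0 <= \esum_(x in F) (pi x)%:E by apply: esum_ge0 => x _; rewrite lee_fin.
have sC0 : 0 <= \esum_(x in ~` F) (pi x)%:E by apply: esum_ge0 => x _; rewrite lee_fin.
have sF1 : \esum_(x in F) (pi x)%:E <= 1 by rewrite -piF leeDl.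
have hFe : 1 - (e / 2)%:E <= \esum_(x in F) (pi x)%:E.
  by rewrite esum_fset//; [exact: ltW|move=> x _; rewrite lee_fin].
apply: (@le_trans _ _ (\esum_(x in [set: S]) ((pi x)%:E * avoid_prob m x))).
  rewrite /escape [leLHS]esum_mkcond; apply: le_esum => x _.
  by case: ifP.
rewrite (esumID F)// !setTI [e]splitr EFinD leeD//.
  apply: (@le_trans _ _ ((e / 2)%:E * \esum_(x in F) (pi x)%:E)).
    rewrite -esumZl//; last exact: ltW.
    apply: le_esum => x Fx; rewrite muleC lee_pmul// ?lee_fin// ?avoid_prob_ge0//.
    exact: le_trans (le_avoid_prob _ nm) (hn x Fx).
  by rewrite -[leRHS]mule1 lee_pmul// lee_fin ltW.
apply: (@le_trans _ _ (\esum_(x in ~` F) (pi x)%:E)).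
  apply: le_esum => x _; rewrite -[leRHS]mule1 lee_pmul// ?lee_fin//.
    exact: avoid_prob_ge0.
  exact: avoid_prob_le1.
move: piF hFe sC0 sF0 sF1.
case: (\esum_(x in F) (pi x)%:E) => [u| |] //; case: (\esum_(x in ~` F) (pi x)%:E) => [v| |] //=.
by move=> [] uv; rewrite -!EFinB !lee_fin; lra.
Qed.

Lemma mean_return_le n : (pi i * mean_return n <= 1)%R.
Proof.
have mr0 : (0 <= pi i * fine (avoid_prob n i))%R.
  by rewrite mulr_ge0// fine_ge0// avoid_prob_ge0.
rewrite -lee_fin -(kac_identity n) /mean_return big_ord_recr /= mulrDr.
rewrite -[leLHS]adde0 leeD ?lee_fin ?lerDl//.
by apply: esum_ge0 => x _; rewrite mule_ge0 ?lee_fin// avoid_prob_ge0.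
Qed.

(** Apply the identity at a horizon so late that the escape probability is below e, replace the mean
    there by its bound at n plus T, and let e tend to 0. *)
Lemma kac_lower_bound n (T : R) : (forall x, recurs x) ->
  (forall m, (n <= m)%N -> mean_return m <= mean_return n + T)%R ->
  (1 <= pi i * (mean_return n + T))%R.
Proof.
move=> rec hT; apply/ler_addgt0Pr => e e0.
have [m hm] := escape_vanishes rec e0.
have := kac_identity (maxn m n); rewrite -lee_fin => <-; rewrite EFinD leeD//.
  rewrite lee_fin ler_wpM2l// hT//; exact: leq_trans (leq_maxr m n) (leqnSn _).
by apply: hm; exact: leq_maxl.
Qed.
End Kac.

(** * Truncated walk lengths and their law *)

Section WalkLength.
Context {R : realType} {S : countType} (i : S).
Implicit Types (x : nat -> S).

(** The working form of the [find] definition: time n always satisfies the search predicate, so the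
    search succeeds, and the index found is one less than the time. *)
Lemma ltn_walk_length n x j :
  (0 < n)%N -> (j < walk_length i n x)%N = (j < n)%N && all (fun t => x t != i) (iota 1 j).
Proof.
move=> n0; rewrite /walk_length ltnS.
set p := fun t => (t == n) || (x t == i).
have hp : has p (iota 1 n).
  by apply/hasP; exists n; rewrite ?mem_iota ?add1n ?n0 ?ltnS /= ?/p ?eqxx// leqnn.
have fn : (find p (iota 1 n) < n)%N by move: hp; rewrite has_find size_iota.
case: (ltnP j n) => /= jn; last by apply/negbTE; rewrite -ltnNge (leq_trans fn).
rewrite leqNgt -has_take// take_iota (minn_idPl (ltnW jn)) -all_predC.
apply: eq_in_all => t; rewrite mem_iota add1n => /andP[_ tj] /=.
by rewrite /p negb_or neq_ltn (leq_trans tj jn).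
Qed.

Lemma walk_length_le n x : (0 < n)%N -> (walk_length i n x <= n)%N.
Proof. by move=> n0; rewrite leqNgt ltn_walk_length// ltnn. Qed.

Lemma walk_length_minn n x : (0 < n)%N ->
  walk_length i n x = minn (walk_length i n.+1 x) n.
Proof.
move=> n0; have H j : (j < walk_length i n x)%N = (j < minn (walk_length i n.+1 x) n)%N.
  rewrite ltn_min !ltn_walk_length//; case: (ltnP j n) => jn; last by rewrite andbF.
  by rewrite andbT ltnS (ltnW jn).
by apply/eqP; rewrite eqn_leq leqNgt H ltnn /= leqNgt -H ltnn.
Qed.

Lemma lt_return_time (k : nat) x :
  ((k%:R)%:E < return_time i x :> \bar R)%E <-> all (fun t => x t != i) (iota 1 k).
Proof.
split => [h|/allP h].
  apply/allP => t; rewrite mem_iota add1n ltnS => /andP[t1 tk].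
  apply/eqP => xt; move: h; rewrite ltNge; apply/negP/negPn.
  apply: (@le_trans _ _ (t%:R%:E)); last by rewrite lee_fin ler_nat.
  by apply: ereal_inf_lbound; exists t.
apply: (@lt_le_trans _ _ (k.+1%:R%:E)); first by rewrite lte_fin ltr_nat.
apply: le_ereal_inf_tmp => _ [t [t1 xt] <-]; rewrite lee_fin ler_nat ltnNge.
by apply/negP => tk; have := h t; rewrite mem_iota t1 add1n ltnS tk xt eqxx => /(_ isT).
Qed.

Lemma truncatedE n x : truncated (R := R) i n x = (n < walk_length i n.+1 x)%N.
Proof.
by rewrite ltn_walk_length// ltnSn /=; apply/idP/idP => /lt_return_time.
Qed.

Section Law.
Context {d : measure_display} {Omega : measurableType d} (X : nat -> Omega -> S).

(** The event constrains only times 1..j, hence is a finite intersection of complements of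
    generators. Membership in the generated sigma-algebra is what the independence hypothesis asks
    for. *)
Lemma sigma_walk_length n j : (0 < n)%N ->
  sigma_of_process X [set w | (j < walk_length i n (X ^~ w))%N].
Proof.
move=> n0; pose G := [set A | exists t y, A = [set w | X t w = y]].
have gen t : measurable ([set w | X t w = i] : set (g_sigma_algebraType G)).
  by apply: sub_sigma_algebra; exists t, i.
case: (ltnP j n) => jn; last first.
  rewrite (_ : mkset _ = set0); first exact: sigma_algebra0.
  by apply/seteqP; split => // w /=; rewrite ltn_walk_length// ltnNge jn.
rewrite (_ : mkset _ = \bigcap_(t in [set t | (1 <= t <= j)%N]) ~` [set w | X t w = i]).
  apply: (@fin_bigcap_measurable _ (g_sigma_algebraType G)).
    apply: (@sub_finite_set _ _ `I_j.+1); last exact: finite_II.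
    by move=> t /= /andP[].
  by move=> t _; exact: measurableC.
apply/seteqP; split => w /=; rewrite ltn_walk_length// jn /=.
  move=> /allP h t /= tj; apply/eqP; apply: (h t).
  by rewrite mem_iota add1n ltnS.
by move=> h; apply/allP => t; rewrite mem_iota add1n ltnS => tj; apply/eqP; exact: (h t).
Qed.

Lemma sigma_walk_length_eq n v : (0 < n)%N ->
  sigma_of_process X [set w | walk_length i n (X ^~ w) = v].
Proof.
move=> n0; pose G := [set A | exists t y, A = [set w | X t w = y]].
have -> : [set w | walk_length i n (X ^~ w) = v] =
    (if v is v'.+1 then [set w | (v' < walk_length i n (X ^~ w))%N] else setT) `\`
    [set w | (v < walk_length i n (X ^~ w))%N].
  apply/seteqP; split => w /=.
    by move=> <-; split; [exact: leqnn|rewrite ltnn].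
  case: v => [|v] [/= h /negP]; rewrite -leqNgt; first by rewrite leqNgt.
  by move=> h'; apply/eqP; rewrite eqn_leq h' h.
apply: (@measurableD _ (g_sigma_algebraType G)); last exact: sigma_walk_length.
by case: v => [|v]; [exact: (@measurableT _ (g_sigma_algebraType G))|exact: sigma_walk_length].
Qed.

Hypothesis mX : forall t y, measurable [set w | X t w = y].

Lemma sigma_of_process_measurable A : sigma_of_process X A -> measurable A.
Proof.
apply: smallest_sub => [|_ [t [x ->]]]; last exact: mX.
by split; [exact: measurable0|by move=> B mB; rewrite setTD; exact: measurableC|exact: bigcupT_measurable].
Qed.

Context (P : probability Omega R) (Q : S -> S -> R).
Hypotheses (sQ : stochastic Q) (mc : markov_chain P Q i X).

Lemma prob_walk_length n j : (j < n)%N ->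
  P [set w | (j < walk_length i n (X ^~ w))%N] = avoid_prob Q i j i.
Proof.
move=> jn; have n0 : (0 < n)%N by exact: leq_ltn_trans jn.
rewrite /avoid_prob -(prob_pass sQ mc); congr (P _).
apply/seteqP; split => w /=; rewrite ltn_walk_length// jn size_nseq /=.
  move=> /allP h t tj; rewrite nth_nseq tj /=; apply/eqP; apply: (h (1 + t)%N).
  by rewrite mem_iota leq_addr ltn_add2l.
move=> h; apply/allP => -[|t]; rewrite mem_iota// !add1n ltnS => tj.
by have := h t tj; rewrite nth_nseq ifT //= add1n => /eqP.
Qed.
End Law.
End WalkLength.

(** * Chernoff bounds for fresh rows of samples *)

Section FiniteSampling.
Context {R : realType} {d : measure_display} {Omega : measurableType d}.
Context (P : probability Omega R).

Lemma fine_prob_ge0 A : 0 <= fine (P A).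
Proof. exact: fine_ge0. Qed.

Lemma fine_prob_le A B : measurable A -> measurable B -> A `<=` B ->
  fine (P A) <= fine (P B).
Proof.
move=> mA mB AB; apply: fine_le; rewrite ?fin_num_measure//.
by apply: le_measure => //; rewrite inE.
Qed.

Lemma fine_prob_partition (I : finType) (W : Omega -> I) (A : set Omega) :
  (forall f, measurable [set w | W w = f]) -> measurable A ->
  fine (P A) = \sum_(f : I) fine (P (A `&` [set w | W w = f])).
Proof.
move=> mW mA; have mAW f : measurable (A `&` [set w | W w = f]) by exact: measurableI.
rewrite sum_fine; last by move=> f _; rewrite fin_num_measure.
congr fine; rewrite -[in LHS](setIT A).
have -> : [set: Omega] = \bigcup_(f in [set: I]) [set w | W w = f].
  by apply/seteqP; split => // w _; exists (W w).
rewrite setI_bigcupr measure_fin_bigcup; last first.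
- by move=> f _; exact: mAW.
- by move=> f g _ _ [w [[_ <-] [_ <-]]].
- exact: finite_finset.
rewrite (_ : [set: I] = [set` enum I]); last first.
  by apply/seteqP; split => // f _ /=; rewrite mem_enum.
by rewrite -fsbig_seq ?enum_uniq// big_enum.
Qed.

(* Markov's inequality for exp (l * sum), conditionally on [E]; the factors are
   bounded by convexity of exp on [0, 1]. *)
Lemma conditional_chernoff (E C : set Omega) (n B : nat) (U : nat -> Omega -> nat)
    (p : nat -> nat -> R) (phi : nat -> R) (l tau m : R) :
  measurable E -> measurable C ->
  (forall s v, (s < n)%N -> measurable [set w | U s w = v]) ->
  (forall s w, (s < n)%N -> (U s w <= B)%N) ->
  (forall s v, 0 <= p s v) ->
  (forall v, 0 <= phi v <= 1) ->
  (forall s, (s < n)%N -> \sum_(v < B.+1) p s v = 1) ->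
  (forall s, (s < n)%N -> \sum_(v < B.+1) p s v * phi v = m) ->
  (forall g : nat -> nat,
    fine (P (E `&` [set w | forall s, (s < n)%N -> U s w = g s])) =
    fine (P E) * \prod_(s < n) p s (g s)) ->
  (forall w, E w -> C w -> l * tau <= l * \sum_(s < n) phi (U s w)) ->
  fine (P (E `&` C)) <= fine (P E) * expR (n%:R * m * (expR l - 1) - l * tau).
Proof.
move=> mE mC mU UB p0 phi01 p1 pm indep EC.
pose W w : {ffun 'I_n -> 'I_B.+1} := [ffun s : 'I_n => inord (U s w)].
have WE w (g : {ffun 'I_n -> 'I_B.+1}) :
    W w = g <-> forall s : 'I_n, U s w = g s.
  split => [<- s|h]; first by rewrite ffunE inordK// ltnS UB.
  by apply/ffunP => s; rewrite ffunE h inord_val.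
pose ng (g : {ffun 'I_n -> 'I_B.+1}) (s : nat) : nat :=
  if insub s is Some s' then g s' else 0%N.
have ngE g (s : 'I_n) : ng g s = g s by rewrite /ng valK.
have WE' g : [set w | W w = g] = [set w | forall s, (s < n)%N -> U s w = ng g s].
  apply/seteqP; split => w /=; first by move/WE => h s sn; rewrite (h (Ordinal sn)) -ngE.
  by move=> h; apply/WE => s; rewrite h ?ngE.
have mW g : measurable [set w | W w = g].
  rewrite WE' (_ : mkset _ = \bigcap_(s in `I_n) [set w | U s w = ng g s]).
    by apply: fin_bigcap_measurable => // s; exact: mU.
  by apply/seteqP; split => w h s; exact: h.
rewrite (fine_prob_partition mW); last exact: measurableI.
pose S (g : {ffun 'I_n -> 'I_B.+1}) := \sum_(s < n) phi (g s).
(* On an atom meeting both [E] and [C] the sum of the [phi] values equals [S g], so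
   [l * tau <= l * S g] and the exponential factor is at least 1; every other atom contributes 0. *)
apply: (@le_trans _ _ (\sum_(g : {ffun 'I_n -> 'I_B.+1})
    fine (P E) * (\prod_(s < n) p s (g s) * expR (l * S g - l * tau)))).
  apply: ler_sum => g _.
  have [[w [[Ew Cw] Ww]]|/nonemptyPn ->] := pselect ((E `&` C `&` [set w | W w = g]) !=set0); last first.
    rewrite measure0 /= mulr_ge0 ?fine_prob_ge0// mulr_ge0 ?expR_ge0//.
    by apply: prodr_ge0.
  apply: (@le_trans _ _ (fine (P (E `&` [set w | W w = g])))).
    by apply: fine_prob_le; [apply: measurableI => //; exact: measurableI|exact: measurableI|move=> v [[]]].
  rewrite WE' indep; under eq_bigr do rewrite ngE.
  rewrite ler_wpM2l ?fine_prob_ge0// ler_peMr ?prodr_ge0//.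
  rewrite -expR0 ler_expR subr_ge0 (le_trans (EC w Ew Cw))//.
  by rewrite le_eqVlt; apply/orP; left; apply/eqP; congr (_ * _); apply: eq_bigr => s _; rewrite (WE w g).1.
rewrite -big_distrr /= ler_wpM2l ?fine_prob_ge0//.
under eq_bigr do rewrite expRD mulrA /S mulr_sumr expR_sum -big_split /=.
rewrite -big_distrl /= expRD ler_wpM2r ?expR_ge0//.
(* The sum over value vectors factors into one moment generating function per sample, each at most
   [1 + m * (expR l - 1)], hence at most [expR (m * (expR l - 1))]. *)
rewrite -(bigA_distr_bigA (fun (s : 'I_n) (v : 'I_B.+1) => p s v * expR (l * phi v))) /=.
rewrite -mulrA mulrC expRM_natr -[X in _ ^+ X]card_ord -prodr_const.
apply: ler_prod => s _; apply/andP; split.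
  by apply: sumr_ge0 => v _; rewrite mulr_ge0 ?expR_ge0.
apply: (@le_trans _ _ (1 + m * (expR l - 1))); last exact: expR_ge1Dx.
rewrite -(pm s)// mulr_suml -[X in _ <= X + _](p1 s)// -big_split /= ler_sum// => v _.
rewrite -mulrA -[X in X + _]mulr1 -mulrDr ler_wpM2l//.
have /andP[f0 f1] := phi01 v.
have := @convex_expR R (Itv01 f0 f1) l 0.
rewrite /= !convRE /= mulr0 addr0 expR0 /unstable.onem mulr1 mulrC => h.
apply: (le_trans h); rewrite le_eqVlt; apply/orP; left; apply/eqP; ring.
Qed.
End FiniteSampling.

Section WalkLaw.
Context {R : realType} {S : countType} (Q : S -> S -> R) (i : S).
Context {d : measure_display} {Omega : measurableType d}.
Context (P : probability Omega R) (X : nat -> Omega -> S).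
Hypotheses (sQ : stochastic Q) (mc : markov_chain P Q i X).
Variable n : nat.

Let U w := walk_length i n.+1 (X ^~ w).
Let p v := fine (P [set w | U w = v]).

Lemma measurable_walk_length_eq v : measurable [set w | U w = v].
Proof.
apply: (@sigma_of_process_measurable _ _ _ X); last exact: sigma_walk_length_eq.
by case: mc.
Qed.

Lemma measurable_walk_length_gt j : measurable [set w | (j < U w)%N].
Proof.
apply: (@sigma_of_process_measurable _ _ _ X); last exact: sigma_walk_length.
by case: mc.
Qed.

Let sum_law (A : set Omega) : measurable A ->
  fine (P A) = \sum_(v < n.+2) fine (P (A `&` [set w | U w = v])).
Proof.
move=> mA; have UE w (v : 'I_n.+2) : (inord (U w) = v) <-> U w = v.
  split => [<-|->]; last exact: inord_val.
  by rewrite inordK// ltnS walk_length_le.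
rewrite (@fine_prob_partition _ _ _ P _ (fun w => inord (U w) : 'I_n.+2))//.
  apply: eq_bigr => v _; congr (fine (P (_ `&` _))).
  by apply/seteqP; split => w /UE.
move=> v; rewrite (_ : mkset _ = [set w | U w = v]); first exact: measurable_walk_length_eq.
by apply/seteqP; split => w /UE.
Qed.

Lemma walk_law_sum1 : \sum_(v < n.+2) p v = 1.
Proof.
transitivity (fine (P setT)); last by rewrite probability_setT.
by rewrite sum_law//; apply: eq_bigr => v _; rewrite setTI.
Qed.

Lemma walk_law_tail j : (j <= n)%N ->
  \sum_(v < n.+2) p v * (j < v)%N%:R = fine (avoid_prob Q i j i).
Proof.
move=> jn; rewrite -(prob_walk_length sQ mc (n := n.+1))//.
rewrite sum_law; last exact: measurable_walk_length_gt.
apply: eq_bigr => v _; case: (ltnP j v) => jv; rewrite ?mulr1 ?mulr0.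
  by congr (fine (P _)); apply/seteqP; split => w /= => [Uv|[]//]; split => //; rewrite -/(U w) Uv.
rewrite (_ : _ `&` _ = set0) ?measure0//.
by apply/seteqP; split => // w [/=]; rewrite /U => jU Uv; move: jU; rewrite Uv ltnNge jv.
Qed.

(** Write min(v, n) as the number of j < n with j < v, exchange the sums and use the tail
    probabilities. *)
Lemma walk_law_mean : \sum_(v < n.+2) p v * (minn v n)%:R = mean_return Q i n.
Proof.
transitivity (\sum_(v < n.+2) \sum_(j < n) p v * (j < v)%N%:R).
  apply: eq_bigr => v _; rewrite -mulr_sumr -natr_sum; congr (_ * _%:R).
  rewrite minnC; move: (v : nat) => {}v; elim: n => [|k IH]; first by rewrite big_ord0 min0n.
  by rewrite big_ord_recr /= -IH; case: ltnP => ?; lia.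
rewrite exchange_big; apply: eq_bigr => j _.
exact: walk_law_tail (ltnW (ltn_ord j)).
Qed.
End WalkLaw.

Section FiniteCodes.
Context {d : measure_display} {Omega : measurableType d} {T : choiceType}.
Variables (U : T -> Omega -> nat) (J : seq T) (B : nat).
Hypothesis mU : forall x v, x \in J -> measurable [set w | U x w = v].
Hypothesis UB : forall x w, x \in J -> (U x w <= B)%N.

(** Packs finitely many bounded variables into one variable with values in a finite type, whose
    fibers are the atoms to condition on. *)
Definition code w : {ffun seq_sub J -> 'I_B.+1} :=
  [ffun x => inord (U (ssval x) w)].

Definition decode (f : {ffun seq_sub J -> 'I_B.+1}) (x : T) : nat :=
  if insub x is Some y then f y else 0%N.

Lemma code_fiber f : [set w | code w = f] = [set w | forall x, x \in J -> U x w = decode f x].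
Proof.
apply/seteqP; split => [w <- x xJ|w h] /=.
  by rewrite /decode (insubT (mem J) xJ) ffunE /= inordK// ltnS UB.
apply/ffunP => -[x xJ]; rewrite ffunE /= h// /decode (insubT (mem J) xJ) inord_val.
by congr (f _); exact: val_inj.
Qed.

Lemma code_agree w w' : code w = code w' -> forall x, x \in J -> U x w = U x w'.
Proof.
move=> ww' x xJ; have h v : [set w | code w = code w'] v -> U x v = decode (code w') x.
  by rewrite code_fiber; apply.
by rewrite (h w ww') (h w' erefl).
Qed.

Lemma measurable_code f : measurable [set w | code w = f].
Proof.
rewrite code_fiber (_ : mkset _ = \bigcap_(x in [set` J]) [set w | U x w = decode f x]).
  by apply: fin_bigcap_measurable; [exact: finite_seq|move=> x; exact: mU].
by apply/seteqP; split => w h x; exact: h.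
Qed.

(** Such a set is a finite union of fibers of [code]. The measurability of events of the algorithm
    rests on this. *)
Lemma measurable_determined (A : set Omega) :
  (forall w w', (forall x, x \in J -> U x w = U x w') -> A w -> A w') -> measurable A.
Proof.
move=> hA; rewrite (_ : A = \bigcup_(f in [set f | exists2 w, A w & code w = f]) [set w | code w = f]).
  by apply: fin_bigcup_measurable => [|f _]; [exact: finite_finset|exact: measurable_code].
apply/seteqP; split => [w Aw|w [f [w' Aw' <-] /= ww']].
  by exists (code w) => //; exists w.
by apply: hA Aw'; apply: code_agree.
Qed.
End FiniteCodes.

Section FreshRows.
Context {R : realType} {S : countType} (Q : S -> S -> R) (i : S).
Context {d : measure_display} {Omega : measurableType d} (P : probability Omega R).
Context (Z : nat -> nat -> nat -> Omega -> S).
Hypotheses (sQ : stochastic Q) (fresh : fresh_realizations P Q i Z).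

(* min(T, theta + 1) determines both the length min(T, theta) of a realization
   and whether it is truncated. *)
Definition walk (x : nat * nat) w := walk_length i (threshold x.1).+1 (Z x.1 x.2 ^~ w).

Definition cells k M : seq (nat * nat) := [seq (j, s) | j <- iota 0 k, s <- iota 0 M].

Lemma mem_cells k M j s : ((j, s) \in cells k M) = (j < k)%N && (s < M)%N.
Proof.
apply/allpairsP/andP => [[[a b] [/= + + [-> ->]]]|[jk sM]].
  by rewrite !mem_iota !add0n.
by exists (j, s); rewrite !mem_iota.
Qed.

Lemma cells_uniq k M : uniq (cells k M).
Proof. by apply: allpairs_uniq; rewrite ?iota_uniq// => -[? ?] [? ?] _ _ [-> ->]. Qed.

Lemma measurable_walk x v : measurable [set w | walk x w = v].
Proof. by case: fresh => mc _; exact: (measurable_walk_length_eq (mc x.1 x.2)). Qed.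

Lemma walk_le x w : (walk x w <= (threshold x.1).+1)%N.
Proof. exact: walk_length_le. Qed.

Lemma measurable_cells k M (A : set Omega) :
  (forall w w', (forall j s, (j < k)%N -> (s < M)%N -> walk (j, s) w = walk (j, s) w') ->
    A w -> A w') -> measurable A.
Proof.
move=> hA; apply: (@measurable_determined _ _ _ walk (cells k M) (threshold k).+1).
- by move=> x v _; exact: measurable_walk.
- move=> [j s] w; rewrite mem_cells => /andP[/= jk _]; apply: (leq_trans (walk_le _ _)).
  by rewrite ltnS leq_exp2l// ltnW.
- move=> w w' h; apply: hA => j s jk sM; apply: h.
  by rewrite mem_cells jk.
Qed.

Lemma prob_walks (J : seq (nat * nat)) (g : nat * nat -> nat) : uniq J ->
  fine (P [set w | forall x, x \in J -> walk x w = g x]) =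
  \prod_(x <- J) fine (P [set w | walk x w = g x]).
Proof.
move=> uJ; case: fresh => _ /(_ J (fun x => [set w | walk x w = g x]) uJ) h.
rewrite (_ : mkset _ = \bigcap_(x in [set` J]) [set w | walk x w = g x]); last first.
  by apply/seteqP; split => w k x; exact: k.
rewrite h; last by move=> x _; exact: (@sigma_walk_length_eq _ _ _ _ (Z x.1 x.2)).
elim: {uJ h} J => [|x J IH]; first by rewrite !big_nil.
rewrite !big_cons fineM ?IH ?fin_num_measure//; try exact: measurable_walk.
by apply: prode_fin_num => y _; rewrite fin_num_measure//; exact: measurable_walk.
Qed.

(* The sample size of row [k] is random but determined by the earlier rows, so
   that the Chernoff bound applies conditionally on each atom of the latter. *)
Lemma row_chernoff k M (N : Omega -> nat) (D : set Omega)
    (phi : nat -> R) (m l beta : R) (tau : nat -> R) :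
  measurable D ->
  (forall w w', (forall j s, (j < k)%N -> (s < M)%N -> walk (j, s) w = walk (j, s) w') ->
    N w = N w') ->
  (forall v, 0 <= phi v <= 1) ->
  (forall s, \sum_(v < (threshold k).+2) fine (P [set w | walk (k, s) w = v]) * phi v = m) ->
  (forall w, D w -> l * tau (N w) <= l * \sum_(s < N w) phi (walk (k, s : nat) w)) ->
  (forall w, D w -> expR ((N w)%:R * m * (expR l - 1) - l * tau (N w)) <= beta) ->
  0 <= beta ->
  fine (P D) <= beta.
Proof.
move=> mD hN phi01 hm D1 D2 beta0.
have UB x w : x \in cells k M -> (walk x w <= (threshold k).+1)%N.
  case: x => j s; rewrite mem_cells => /andP[jk _]; apply: (leq_trans (walk_le _ _)).
  by rewrite ltnS leq_exp2l// ltnW.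
have mW := measurable_code (fun x v _ => measurable_walk x v) UB.
rewrite (fine_prob_partition P mW mD).
apply: (@le_trans _ _ (\sum_f fine (P [set w | code walk (cells k M) (threshold k).+1 w = f]) * beta)).
  apply: ler_sum => f _; set E := [set w | _ = f].
  have [[w0 [Dw0 Ew0]]|/nonemptyPn ->] := pselect ((D `&` E) !=set0); last first.
    by rewrite measure0 mulr_ge0 ?fine_prob_ge0.
  (* On an atom of the earlier rows the sample size is a constant, so the conditional bound applies
     with a fixed number of samples. *)
  have NE w : E w -> N w = N w0.
    move=> Ew; apply: hN => j s jk sM.
    by apply: (code_agree (B := (threshold k).+1) UB); rewrite ?mem_cells ?jk// Ew.
  apply: (@le_trans _ _ (fine (P E) * expR ((N w0)%:R * m * (expR l - 1) - l * tau (N w0)))); last first.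
    by rewrite ler_wpM2l ?fine_prob_ge0// D2.
  rewrite setIC; apply: (@conditional_chernoff _ _ _ P E D (N w0) (threshold k).+1 (fun s => walk (k, s))
    (fun s v => fine (P [set w | walk (k, s) w = v])) phi l (tau (N w0)) m) => //.
  - exact: mW.
  - by move=> s v _; exact: measurable_walk.
  - by move=> s w _; exact: walk_le.
  - by move=> s v; exact: fine_prob_ge0.
  - by move=> s _; case: fresh => mc _; exact: (walk_law_sum1 (mc k s)).
  - move=> g; pose J := [seq (k, s) | s <- iota 0 (N w0)].
    have uJ : uniq (cells k M ++ J).
      rewrite cat_uniq cells_uniq /= map_inj_uniq ?iota_uniq ?andbT; last by move=> ? ? [].
      by apply/hasPn => _ /mapP[s _ ->] /=; rewrite mem_cells ltnn.
    (* [G] prescribes the past on the cells and g on row k. These are distinct realizations, so the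
       joint probability factors as the conditional bound requires. *)
    pose G x := if x.1 == k then g x.2 else decode f x.
    have GE x : x \in cells k M -> G x = decode f x.
      case: x => j s; rewrite mem_cells => /andP[jk _].
      by rewrite /G /= ltn_eqF.
    have := prob_walks G uJ; rewrite big_cat /= big_map.
    rewrite -[X in iota 0 X]subn0 -/(index_iota 0 (N w0)).
    have -> : \prod_(x <- cells k M) fine (P [set w | walk x w = G x]) = fine (P E).
      rewrite /E code_fiber// prob_walks ?cells_uniq//.
      by rewrite big_seq [RHS]big_seq; apply: eq_bigr => x /GE ->.
    rewrite big_mkord => h.
    transitivity (fine (P [set w | forall x, x \in cells k M ++ J -> walk x w = G x])).
      congr (fine (P _)); rewrite /E code_fiber//; apply/seteqP; split => w /=.
        move=> [h1 h2] x; rewrite mem_cat => /orP[xc|/mapP[s + ->]].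
          by rewrite GE// h1.
        by rewrite mem_iota /G /= eqxx; exact: h2.
      move=> hw; split => [x xc|s sN].
        by rewrite -GE// hw// mem_cat xc.
      by rewrite hw /G /= ?eqxx// mem_cat map_f ?orbT// mem_iota.
    by rewrite h; congr (_ * _); apply: eq_bigr => s _; rewrite /G /= eqxx.
  - by move=> w Ew Dw; have := D1 w Dw; rewrite NE.
rewrite -mulr_suml -[leRHS]mul1r ler_wpM2r//.
have := fine_prob_partition P mW measurableT; rewrite probability_setT /= => ->.
by apply: ler_sum => f _; rewrite setTI.
Qed.
End FreshRows.

(** * The algorithm on a fixed run *)

Section Refinement.
Context {R : realType} {S : countType} (i : S) (eps alpha : R).
Hypotheses (eps0 : 0 < eps) (eps1 : eps < 1) (alpha0 : 0 < alpha) (alpha1 : alpha < 1).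
Implicit Types (z : nat -> nat -> nat -> S).

Lemma nceil_ge (y : R) : 0 <= y -> y <= (nceil y)%:R.
Proof.
move=> y0; rewrite /nceil natr_absz ger0_norm ?ceil_ge//.
by rewrite -(ler_int R) (le_trans y0)// ceil_ge.
Qed.

Lemma nceil_lt (y : R) : 0 <= y -> (nceil y)%:R < y + 1.
Proof.
move=> y0; rewrite /nceil natr_absz ger0_norm.
  by rewrite -ltrBlDr (le_lt_trans _ (ceilB1_lt y))// intrB.
by rewrite -(ler_int R) (le_trans y0)// ceil_ge.
Qed.

Lemma le_nceil (x y : R) : 0 <= x -> x <= y -> (nceil x <= nceil y)%N.
Proof.
move=> x0 xy; have y0 := le_trans x0 xy.
rewrite -ltnS -(ltr_nat R); apply: (lt_le_trans (nceil_lt x0)).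
by rewrite -natr1 lerD2r (le_trans xy)// nceil_ge.
Qed.

(** Chosen so that [expR (- log_term k)] is alpha / (4 theta_k), the failure probability allotted to
    one tail in iteration k. *)
Definition log_term k : R := ln (4 * (threshold k)%:R / alpha).

Definition budget k : R := 3 * (1 + eps) * (threshold k)%:R * log_term k / eps ^+ 2.

(** With value 1 at the first iteration, the separate formula for N^(1) becomes an instance of the
    general one, since theta_1 = 2. *)
Definition last_mean z k : R := if k is k'.+1 then (if k' == 0%N then 1 else T_hat i eps alpha z k') else 1.

Lemma sample_sizeE z k : (0 < k)%N ->
  sample_size i eps alpha z k = nceil (budget k / last_mean z k).
Proof.
case: k => // -[|k] _ /=.
  rewrite /budget /log_term /threshold expn1; congr (nceil _); rewrite divr1.
  by congr (_ / _); rewrite (_ : 4 * 2 = 8 :> R); [ring|lra].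
by congr (nceil _); rewrite invfM mulrA mulrAC.
Qed.

Lemma threshold_ge2 k : (0 < k)%N -> 2 <= (threshold k)%:R :> R.
Proof. by case: k => // k _; rewrite ler_nat /threshold expnS leq_pmulr// expn_gt0. Qed.

Lemma threshold_gt0 k : 0 < (threshold k)%:R :> R.
Proof. by rewrite ltr0n expn_gt0. Qed.

Lemma expR_log_term k : expR (- log_term k) = alpha / (4 * (threshold k)%:R).
Proof.
have t0 := threshold_gt0 k.
by rewrite expRN lnK ?posrE ?invf_div// divr_gt0// mulr_gt0.
Qed.

Lemma log_term_ge1 k : (0 < k)%N -> 1 <= log_term k.
Proof.
move=> k0; have t2 := threshold_ge2 k0.
rewrite -[1]expRK ler_ln ?posrE ?expR_gt0//; last by rewrite divr_gt0// mulr_gt0// threshold_gt0.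
rewrite ler_pdivlMr//; apply: (@le_trans _ _ 8); last by lra.
apply: (@le_trans _ _ (expR 1)); first by rewrite ger_pMr ?expR_gt0// ltW.
by have := expR1_le4 (R := R); lra.
Qed.

Lemma budget_gt0 k : (0 < k)%N -> 0 < budget k.
Proof.
move=> k0; rewrite /budget divr_gt0 ?exprn_gt0// !mulr_gt0 ?threshold_gt0//.
  by rewrite addr_gt0.
exact: lt_le_trans (log_term_ge1 k0).
Qed.

Lemma mean_length_itv z k N : (0 < N)%N ->
  1 <= mean_length (R := R) i z k N <= (threshold k)%:R.
Proof.
move=> N0; have N0' : 0 < N%:R :> R by rewrite ltr0n.
have sumc (c : R) : \sum_(s < N) c = c * N%:R.
  by rewrite sumr_const card_ord mulr_natr.
rewrite /mean_length ler_pdivlMr// ler_pdivrMr//; apply/andP; split.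
  by rewrite -sumc; apply: ler_sum => s _; rewrite ler1n.
by rewrite -sumc; apply: ler_sum => s _; rewrite ler_nat walk_length_le// expn_gt0.
Qed.

Lemma sample_size_gt0 z k : (0 < k)%N -> (0 < sample_size i eps alpha z k)%N.
Proof.
elim: k => // k IH _; rewrite sample_sizeE//.
suff h : 0 < budget k.+1 / last_mean z k.+1.
  by rewrite -(ltr_nat R) (lt_le_trans h)// nceil_ge// ltW.
rewrite divr_gt0 ?budget_gt0//= ; case: k IH => //= k /(_ isT) /(mean_length_itv z k.+1).
by case/andP => h _; exact: lt_le_trans h.
Qed.

Lemma T_hat_itv z k : (0 < k)%N -> 1 <= T_hat i eps alpha z k <= (threshold k)%:R.
Proof. by move=> k0; apply: mean_length_itv; exact: sample_size_gt0. Qed.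

Lemma last_mean_itv z k : (0 < k)%N -> 1 <= last_mean z k <= (threshold k)%:R / 2.
Proof.
case: k => // -[|k] _ /=; first by rewrite /threshold expn1; lra.
have /andP[-> /le_trans ->]// := T_hat_itv z (ltn0Sn k).
by rewrite /threshold (expnS 2 k.+1) natrM; lra.
Qed.

Lemma sample_size_le z k : (0 < k)%N -> (sample_size i eps alpha z k <= nceil (budget k))%N.
Proof.
move=> k0; rewrite sample_sizeE//; have /andP[m1 _] := last_mean_itv z k0.
have b0 := budget_gt0 k0; have m0 : 0 < last_mean z k by exact: lt_le_trans m1.
apply: le_nceil; first by rewrite divr_ge0// ltW.
by rewrite ler_pdivrMr// ler_peMr// ltW.
Qed.

Lemma sample_size_ge z k : (0 < k)%N ->
  budget k <= (sample_size i eps alpha z k)%:R * last_mean z k.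
Proof.
move=> k0; rewrite sample_sizeE//; have /andP[m1 _] := last_mean_itv z k0.
have b0 := budget_gt0 k0; have m0 : 0 < last_mean z k by exact: lt_le_trans m1.
by rewrite -ler_pdivrMr// nceil_ge// divr_ge0// ltW.
Qed.

(** The factor 1 + eps in the sample size compensates for an overestimate by the preceding
    iteration; what remains is the normalized expected sum that the Chernoff exponent needs. *)
Lemma sample_size_mean z k (mu : R) : (0 < k)%N -> 0 < mu ->
  last_mean z k <= (1 + eps) * mu ->
  3 * log_term k <= eps ^+ 2 * ((sample_size i eps alpha z k)%:R * (mu / (threshold k)%:R)).
Proof.
move=> k0 mu0 hmu; have t0 := threshold_gt0 k.
have h := le_trans (sample_size_ge z k0) (ler_wpM2l (ler0n _ _) hmu).
have e2 : 0 < eps ^+ 2 by rewrite exprn_gt0.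
rewrite mulrC [X in _ <= _ * X]mulrC mulrA -[X in _ <= X]mulrC.
rewrite /budget ler_pdivrMr// in h.
rewrite -(@ler_pM2r _ ((1 + eps) * (threshold k)%:R)); last by rewrite mulr_gt0// addr_gt0.
have -> : log_term k * 3 * ((1 + eps) * (threshold k)%:R) =
    3 * (1 + eps) * (threshold k)%:R * log_term k by ring.
apply: (le_trans h); rewrite le_eqVlt; apply/orP; left; apply/eqP.
by field; rewrite gt_eqF.
Qed.

(** The preceding estimate is at most theta_k / 2 on every run, accurate or not, so the threshold
    cancels from the sample size. Used for the truncation frequency. *)
Lemma sample_size_large z k : (0 < k)%N ->
  6 * log_term k <= eps ^+ 2 * (sample_size i eps alpha z k)%:R.
Proof.
move=> k0; have t0 := threshold_gt0 k; have /andP[_ m2] := last_mean_itv z k0.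
have L1 := log_term_ge1 k0.
have h := le_trans (sample_size_ge z k0) (ler_wpM2l (ler0n _ _) m2).
have e2 : 0 < eps ^+ 2 by rewrite exprn_gt0.
rewrite /budget ler_pdivrMr// in h.
rewrite -(@ler_pM2r _ ((threshold k)%:R / 2)); last by rewrite divr_gt0.
apply: (@le_trans _ _ (3 * (1 + eps) * (threshold k)%:R * log_term k)).
  have : 0 <= (threshold k)%:R * log_term k by rewrite mulr_ge0 ?ltW// (lt_le_trans _ L1).
  have -> : 3 * (1 + eps) * (threshold k)%:R * log_term k =
      3 * (1 + eps) * ((threshold k)%:R * log_term k) by ring.
  have -> : 6 * log_term k * ((threshold k)%:R / 2) = 3 * ((threshold k)%:R * log_term k) by field.
  by move=> tL; rewrite -[X in _ <= X]mulrA ler_pM2l// ler_peMl// lerDl ltW.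
by apply: (le_trans h); rewrite le_eqVlt; apply/orP; left; apply/eqP; ring.
Qed.

(** From [N < budget / last_mean + 1]: the main term is at most 24 * 3 * (1 + eps) <= 144 units
    theta_k * log_term / eps^2, and rounding adds one T_hat <= theta_k, at most one unit more. *)
Lemma steps_le z k : (0 < k)%N -> T_hat i eps alpha z k <= 24 * last_mean z k ->
  steps i eps alpha z k <= 145 * (threshold k)%:R * log_term k / eps ^+ 2.
Proof.
move=> k0 h24; have t0 := threshold_gt0 k; have /andP[m1 _] := last_mean_itv z k0.
have L1 := log_term_ge1 k0; have /andP[T1 T2] := T_hat_itv z k0.
have b0 := budget_gt0 k0; have m0 : 0 < last_mean z k by exact: lt_le_trans m1.
have e2 : 0 < eps ^+ 2 by rewrite exprn_gt0.
have e21 : eps ^+ 2 <= 1 by rewrite exprn_ile1// ltW.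
set T := T_hat _ _ _ _ _ in h24 T1 T2 *; rewrite /steps -/T.
have N1 : (sample_size i eps alpha z k)%:R < budget k / last_mean z k + 1.
  by rewrite sample_sizeE// nceil_lt// divr_ge0// ltW.
have T0 : 0 <= T by lra.
apply: (le_trans (ler_wpM2r T0 (ltW N1))); rewrite mulrDl mul1r.
have -> : budget k / last_mean z k * T = budget k * (T / last_mean z k) by ring.
have Tm : T / last_mean z k <= 24 by rewrite ler_pdivrMr.
have h1 : budget k * (T / last_mean z k) <= 144 * ((threshold k)%:R * log_term k / eps ^+ 2).
  apply: (le_trans (ler_wpM2l (ltW b0) Tm)).
  have -> : budget k * 24 = 72 * (1 + eps) * ((threshold k)%:R * log_term k / eps ^+ 2).
    by rewrite /budget; ring.
  have L0 : 0 <= log_term k by lra.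
  rewrite ler_wpM2r//; first by rewrite divr_ge0 ?(ltW e2)// mulr_ge0.
  have -> : 144 = 72 * 2 :> R by rewrite -natrM.
  by rewrite ler_pM2l// (_ : 2 = 1 + 1 :> R)// lerD2l ltW.
have h2 : T <= (threshold k)%:R * log_term k / eps ^+ 2.
  rewrite ler_pdivlMr//; apply: (@le_trans _ _ T); first by rewrite ler_piMr.
  by apply: (le_trans T2); rewrite ler_peMr// ltW.
have -> : 145 * (threshold k)%:R * log_term k / eps ^+ 2 =
  144 * ((threshold k)%:R * log_term k / eps ^+ 2) + (threshold k)%:R * log_term k / eps ^+ 2 by ring.
exact: lerD.
Qed.

Definition agree k M z z' := forall j s, (j < k)%N -> (s < M)%N ->
  walk_length i (threshold j).+1 (z j s) = walk_length i (threshold j).+1 (z' j s).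

(** A deterministic cap on the sample sizes of iterations 1..k, so that these iterations read only
    finitely many realizations although their sample sizes are random. *)
Definition sample_cap k : nat := (\max_(j < k.+1) nceil (budget j))%N.

Lemma sample_size_cap z k j : (0 < j <= k)%N ->
  (sample_size i eps alpha z j <= sample_cap k)%N.
Proof.
move=> /andP[j0 jk]; apply: leq_trans (sample_size_le z j0) _.
have jk' : (j < k.+1)%N by rewrite ltnS.
exact: (@leq_bigmax _ (fun j : 'I_k.+1 => nceil (budget j)) (Ordinal jk')).
Qed.

Lemma mean_length_agree k j N M z z' : agree k M z z' -> (j < k)%N -> (N <= M)%N ->
  mean_length i z j N = mean_length i z' j N :> R.
Proof.
move=> h jk NM; rewrite /mean_length; congr (_ / _); apply: eq_bigr => s _.
have t0 : (0 < threshold j)%N by rewrite expn_gt0.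
by rewrite (walk_length_minn i (z j s) t0) (walk_length_minn i (z' j s) t0) h// (leq_trans (ltn_ord s)).
Qed.

(** By induction, the size of row k is computed from rows below k only; this lets [row_chernoff]
    condition on the past. *)
Lemma sample_size_agree k K z z' : (k <= K)%N -> agree k (sample_cap K) z z' ->
  sample_size i eps alpha z k = sample_size i eps alpha z' k.
Proof.
elim: k => // k IH kK h; have hk : agree k (sample_cap K) z z'.
  by move=> j s jk; apply: h; exact: ltnW.
have lm : last_mean z k.+1 = last_mean z' k.+1.
  rewrite /last_mean; case: ifPn => // k0; rewrite /T_hat (IH (ltnW kK) hk).
  apply: (mean_length_agree h) => //; apply: sample_size_cap.
  by rewrite lt0n k0 ltnW.
by rewrite !sample_sizeE// lm.
Qed.

Section Agree.
Variables (k K : nat) (z z' : nat -> nat -> nat -> S).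
Hypotheses (k0 : (0 < k)%N) (kK : (k <= K)%N) (zz' : agree k.+1 (sample_cap K) z z').

Lemma agree_sample_size : sample_size i eps alpha z k = sample_size i eps alpha z' k.
Proof. by apply: (sample_size_agree kK) => j s jk; apply: zz'; exact: ltnW. Qed.

Lemma agree_T_hat : T_hat i eps alpha z k = T_hat i eps alpha z' k.
Proof.
rewrite /T_hat -agree_sample_size; apply: (mean_length_agree zz') => //.
by apply: sample_size_cap; rewrite k0.
Qed.

Lemma agree_p_hat : p_hat i eps alpha z k = p_hat i eps alpha z' k.
Proof.
rewrite /p_hat -agree_sample_size; congr (_ / _); apply: eq_bigr => s _.
rewrite !truncatedE zz'// (leq_trans (ltn_ord s))//.
by apply: sample_size_cap; rewrite k0.
Qed.

Lemma agree_steps : steps i eps alpha z k = steps i eps alpha z' k.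
Proof. by rewrite /steps agree_sample_size agree_T_hat. Qed.
End Agree.
End Refinement.

(** * Accuracy of the estimates *)

Section MeanReturn.
Context {R : realType} {S : countType} (Q : S -> S -> R) (i : S).
Hypothesis sQ : stochastic Q.

Lemma mean_return_ge1 n : (0 < n)%N -> 1 <= mean_return Q i n.
Proof.
case: n => // n _; rewrite /mean_return big_ord_recl /= lerDl.
by apply: sumr_ge0 => j _; rewrite fine_ge0// avoid_prob_ge0.
Qed.

Lemma le_mean_return m n : (m <= n)%N -> mean_return Q i m <= mean_return Q i n.
Proof.
move=> /subnK <-; elim: (n - m)%N => // k; move/le_trans; apply.
by rewrite addSn /mean_return big_ord_recr /= lerDl fine_ge0// avoid_prob_ge0.
Qed.

(** The summands decrease, so the second half of the sum is at most the first. *)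
Lemma mean_return_double n : mean_return Q i (n + n) <= 2 * mean_return Q i n.
Proof.
rewrite /mean_return big_split_ord /= mulrDl mul1r lerD2l; apply: ler_sum => j _.
by apply: fine_le; rewrite ?avoid_prob_fin// le_avoid_prob// leq_addl.
Qed.
End MeanReturn.

Section Concentration.
Context {R : realType} {S : countType} (Q : S -> S -> R) (i : S).
Context {d : measure_display} {Omega : measurableType d} (P : probability Omega R).
Context (Z : nat -> nat -> nat -> Omega -> S).
Hypotheses (sQ : stochastic Q) (fresh : fresh_realizations P Q i Z).
Context (eps alpha : R).
Hypotheses (eps0 : 0 < eps) (eps1 : eps < 1) (alpha0 : 0 < alpha) (alpha1 : alpha < 1).

Let run (w : Omega) k s t := Z k s t w.
Let N k w := sample_size i eps alpha (run w) k.
Let T k w := T_hat i eps alpha (run w) k.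
Let mu k := mean_return Q i (threshold k).

Lemma measurable_run K (A : set Omega) :
  (forall w w', agree i K.+1 (sample_cap eps alpha K) (run w) (run w') -> A w -> A w') ->
  measurable A.
Proof. by move=> hA; apply: (@measurable_cells _ _ _ _ _ _ _ _ fresh K.+1 (sample_cap eps alpha K)). Qed.

Let mu_gt0 k : 0 < mu k.
Proof. by apply: lt_le_trans (mean_return_ge1 i sQ _); rewrite // expn_gt0. Qed.

Let theta_gt0 k : 0 < (threshold k)%:R :> R.
Proof. exact: threshold_gt0. Qed.

Let sum_T k w : (0 < k)%N ->
  \sum_(s < N k w) (minn (walk_length i (threshold k).+1 (run w k s)) (threshold k))%:R / (threshold k)%:R
  = (N k w)%:R * (T k w / (threshold k)%:R).
Proof.
move=> k0; rewrite -mulr_suml mulrA; congr (_ / _); rewrite /T /T_hat /mean_length mulrC.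
rewrite divfK; last by rewrite pnatr_eq0 -lt0n; exact: sample_size_gt0.
by apply: eq_bigr => s _; rewrite -walk_length_minn// expn_gt0.
Qed.

(* With [l] > 0 this bounds the upper tail of [T k], with [l] < 0 the lower one. *)
Let T_deviation k (D : set Omega) (l c : R) : (0 < k)%N -> measurable D ->
  (forall w, D w -> last_mean i eps alpha (run w) k <= (1 + eps) * mu k) ->
  (forall w, D w -> l * (c * mu k) <= l * T k w) ->
  expR l - 1 - l * c <= - (eps ^+ 2 / 3) ->
  fine (P D) <= alpha / (4 * (threshold k)%:R).
Proof.
move=> k0 mD D1 D2 hl; rewrite -expR_log_term//.
have th := theta_gt0 k.
apply: (@row_chernoff _ _ Q i _ _ P Z fresh k (sample_cap eps alpha k) (N k) D
  (fun v => (minn v (threshold k))%:R / (threshold k)%:R) (mu k / (threshold k)%:R) l _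
  (fun n => c * (n%:R * (mu k / (threshold k)%:R)))) => //.
- by move=> w w' h; rewrite /N; exact:
    (@sample_size_agree _ _ i eps alpha eps0 alpha0 alpha1 k k _ _ (leqnn k) h).
- by move=> v; rewrite divr_ge0// ler_pdivrMr// mul1r ler_nat geq_minr.
- move=> s; under eq_bigr do rewrite mulrA.
  rewrite -mulr_suml; congr (_ / _); case: fresh => mc _.
  exact: (walk_law_mean sQ (mc k s)).
- move=> w Dw; rewrite (sum_T w k0).
  have -> : l * (c * ((N k w)%:R * (mu k / (threshold k)%:R))) =
      (N k w)%:R / (threshold k)%:R * (l * (c * mu k)) by ring.
  have -> : l * ((N k w)%:R * (T k w / (threshold k)%:R)) =
      (N k w)%:R / (threshold k)%:R * (l * T k w) by ring.
  by rewrite ler_wpM2l ?D2// divr_ge0.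
- move=> w Dw; rewrite ler_expR.
  have := @sample_size_mean _ _ i eps alpha eps0 alpha0 alpha1 (run w) k (mu k) k0 (mu_gt0 k) (D1 w Dw).
  rewrite -/(N k w) => h.
  have X0 : 0 <= (N k w)%:R * (mu k / (threshold k)%:R).
    by rewrite mulr_ge0// divr_ge0// ltW.
  (* With X = N mu_k / theta_k the exponent is X (exp l - 1 - l c) <= - X eps^2 / 3, and [h] says X
     eps^2 >= 3 [log_term]. *)
  rewrite (_ : _ - _ = (N k w)%:R * (mu k / (threshold k)%:R) * (expR l - 1 - l * c)); last by ring.
  apply: (le_trans (ler_wpM2l X0 hl)); lra.
Qed.

Let low k := (1 - 5 / 6 * eps) * mu k.
Let high k := (1 + eps) * mu k.

Definition accurate K w := forall k, (0 < k <= K)%N -> low k <= T k w <= high k.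

Lemma measurable_accurate K : measurable [set w | accurate K w].
Proof.
apply: (@measurable_run K) => w w' h hw k /andP[k0 kK]; rewrite /T.
rewrite -(@agree_T_hat _ _ i eps alpha eps0 alpha0 alpha1 k K (run w))//; first by apply: hw; rewrite k0.
by move=> j s jk; apply: h; exact: leq_trans jk _.
Qed.

(** Accuracy so far makes the next sample size sufficient: the preceding estimate is below (1 + eps)
    mu_K and mu is nondecreasing; at the first iteration 1 <= mu_1. *)
Lemma last_mean_accurate K w : accurate K w ->
  last_mean i eps alpha (run w) K.+1 <= high K.+1.
Proof.
have mono : mu K <= mu K.+1 by apply: le_mean_return => //; rewrite leq_exp2l.
case: K mono => [|K] mono hK; rewrite /last_mean /=.
  have mu1 : 1 <= mu 1%N by apply: mean_return_ge1 => //; rewrite expn_gt0.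
  by apply: (le_trans mu1); rewrite ler_peMl ?(ltW (mu_gt0 _))// lerDl ltW.
have /andP[_ h] := hK K.+1 (leqnn _); apply: (le_trans h).
by rewrite ler_wpM2l// addr_ge0// ltW.
Qed.

(** Union bound: iteration k adds two tails of alpha / (4 theta_k), and the sum of 2^(-k) for k =
    1..K is 1 - 2^(-K). *)
Lemma prob_inaccurate K :
  fine (P [set w | ~ accurate K w]) <= alpha / 2 * (1 - (threshold K)%:R^-1).
Proof.
elim: K => [|K IH].
  rewrite /threshold expn0 invr1 subrr mulr0 (_ : mkset _ = set0) ?measure0//.
  by apply/seteqP; split => // w; apply => -[|k].
pose lm w := last_mean i eps alpha (run w) K.+1.
have lmE w w' : agree i K.+2 (sample_cap eps alpha K.+1) (run w) (run w') -> lm w = lm w'.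
  rewrite /lm /last_mean => h; case: ifPn => // K0.
  apply: (@agree_T_hat _ _ i eps alpha eps0 alpha0 alpha1 K K.+1); rewrite ?lt0n//.
  by move=> j s jK; apply: h; exact: ltnW.
have TE w w' : agree i K.+2 (sample_cap eps alpha K.+1) (run w) (run w') -> T K.+1 w = T K.+1 w'.
  by move=> h; apply: (@agree_T_hat _ _ i eps alpha eps0 alpha0 alpha1 K.+1 K.+1).
(* The bound on the preceding estimate is built into both events, since the deviation bound needs an
   adequate sample size. *)
pose A := [set w | lm w <= high K.+1 /\ high K.+1 < T K.+1 w].
pose B := [set w | lm w <= high K.+1 /\ T K.+1 w < low K.+1].
have mA : measurable A.
  by apply: (@measurable_run K.+1) => w w' h; rewrite /A /= (lmE _ _ h) (TE _ _ h).
have mB : measurable B.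
  by apply: (@measurable_run K.+1) => w w' h; rewrite /B /= (lmE _ _ h) (TE _ _ h).
have mG k : measurable [set w | ~ accurate k w].
  exact: measurableC (measurable_accurate k).
have sub : [set w | ~ accurate K.+1 w] `<=` [set w | ~ accurate K w] `|` (A `|` B).
  move=> w /= bad; have [gK|] := pselect (accurate K w); last by left.
  have hl := last_mean_accurate gK; right; apply: contrapT => nAB; apply: bad => k /andP[k0].
  rewrite leq_eqVlt ltnS => /orP[/eqP ->|kK]; last by apply: gK; rewrite k0.
  apply/andP; split; rewrite leNgt; apply/negP => h; apply: nAB; first by right.
  by left.
have PA : fine (P A) <= alpha / (4 * (threshold K.+1)%:R).
  (* With l = 2 eps / 3 the quadratic bound gives exactly 3/4 l^2 - l eps = - eps^2 / 3. *)
  apply: (@T_deviation K.+1 A (2 / 3 * eps) (1 + eps)) => //.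
  - by move=> w [].
  - by move=> w [_ /ltW h]; rewrite ler_wpM2l// mulr_ge0// ltW.
  - have : 0 <= 2 / 3 * eps <= 2 / 3 by move: eps0 eps1 => e0 e1; apply/andP; split; lra.
    move=> /expR_upper h.
    have -> : - (eps ^+ 2 / 3) =
        1 + 2 / 3 * eps + 3 / 4 * (2 / 3 * eps) ^+ 2 - 1 - 2 / 3 * eps * (1 + eps) by field.
    by rewrite !lerD2r.
have PB : fine (P B) <= alpha / (4 * (threshold K.+1)%:R).
  (* With l = - x and x = 5 eps / 6, the exponent is at most - x^2 / 2 = - 25 eps^2 / 72, just below
     - eps^2 / 3. *)
  apply: (@T_deviation K.+1 B (- (5 / 6 * eps)) (1 - 5 / 6 * eps)) => //.
  - by move=> w [].
  - by move=> w [_ /ltW h]; rewrite !mulNr lerN2 ler_wpM2l// mulr_ge0// ltW.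
  - have : 0 <= 5 / 6 * eps by rewrite mulr_ge0// ltW.
    move=> /expRN_upper h; have : 0 <= eps ^+ 2 by exact: sqr_ge0.
    lra.
have U2 A' B' : measurable A' -> measurable B' -> fine (P (A' `|` B')) <= fine (P A') + fine (P B').
  move=> mA' mB'; rewrite -fineD ?fin_num_measure//; apply: fine_le; rewrite ?fin_numD ?fin_num_measure//.
    exact: measurableU.
  exact: measureU2.
apply: (le_trans (fine_prob_le _ (mG _) _ sub)); first by do 2 apply: measurableU => //.
apply: (le_trans (U2 _ _ (mG _) _)); first exact: measurableU.
apply: (le_trans (lerD IH (le_trans (U2 _ _ mA mB) (lerD PA PB)))).
have -> : (threshold K.+1)%:R = 2 * (threshold K)%:R :> R by rewrite /threshold expnS natrM.
rewrite le_eqVlt; apply/orP; left; apply/eqP; field.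
by rewrite gt_eqF.
Qed.
End Concentration.

(** The first stopping iteration is at most K, and the step counts are nonnegative. *)
Lemma stops_withinI (R : realType) (S : countType) (i : S) (eps alpha : R)
    (z : nat -> nat -> nat -> S) (stop : nat -> Prop) (bound : R) (K : nat) :
  (0 < K)%N -> stop K -> \sum_(1 <= k < K.+1) steps i eps alpha z k <= bound ->
  stops_within i eps alpha z stop bound.
Proof.
move=> K0 stK le_bound.
have ex : exists k, (0 < k)%N && `[< stop k >] by exists K; rewrite K0; apply/asboolP.
exists (ex_minn ex); case: ex_minnP => m /andP[m0 /asboolP stm] min; split => //.
  move=> k /andP[k0 km] stk; suff : (m <= k)%N by rewrite leqNgt km.
  by apply: min; rewrite k0; apply/asboolP.
have mK : (m <= K)%N by apply: min; rewrite K0; apply/asboolP.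
apply: le_trans le_bound; rewrite [leRHS](big_cat_nat (n := m.+1))//= lerDl.
apply: sumr_ge0 => k _; rewrite /steps mulr_ge0// /T_hat /mean_length divr_ge0//.
by apply: sumr_ge0.
Qed.

(** * Probability of stopping and total cost *)

Section Stopping.
Context {R : realType} {S : countType} (Q : S -> S -> R) (i : S).
Context {d : measure_display} {Omega : measurableType d} (P : probability Omega R).
Context (Z : nat -> nat -> nat -> Omega -> S).
Hypotheses (sQ : stochastic Q) (fresh : fresh_realizations P Q i Z).
Context (eps alpha : R).
Hypotheses (eps0 : 0 < eps) (eps1 : eps < 1) (alpha0 : 0 < alpha) (alpha1 : alpha < 1).

Let run (w : Omega) k s t := Z k s t w.

(** Chernoff at l = 1 for the truncation indicators: as e <= 4, the exponent is at most N eps (1/8 -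
    2/3), below - [log_term] because N eps^2 >= 6 [log_term]. Finally theta_k >= 2 turns alpha / (4
    theta_k) into alpha / 8. *)
Lemma prob_p_hat_large k : (0 < k)%N ->
  fine (avoid_prob Q i (threshold k) i) <= eps / 24 ->
  fine (P [set w | 2 * eps / 3 <= p_hat i eps alpha (run w) k]) <= alpha / 8.
Proof.
move: eps0 eps1 alpha0 => e0 e1 a0 k0 hp; set D := [set w | _].
have mD : measurable D.
  apply: (measurable_run fresh (eps := eps) (alpha := alpha) (K := k)) => w w' h; rewrite /D /=.
  by rewrite (@agree_p_hat _ _ i eps alpha eps0 alpha0 alpha1 k k (run w) (run w') k0 (leqnn k) h).
apply: (@le_trans _ _ (expR (- log_term alpha k))); last first.
  rewrite expR_log_term// ler_pM2l// lef_pV2 ?posrE ?mulr_gt0 ?threshold_gt0//.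
  by have := threshold_ge2 (R := R) k0; lra.
pose N w := sample_size i eps alpha (run w) k.
apply: (@row_chernoff _ _ Q i _ _ P Z fresh k (sample_cap eps alpha k) N D
  (fun v => (threshold k < v)%N%:R) (fine (avoid_prob Q i (threshold k) i)) 1 _
  (fun n => n%:R * (2 * eps / 3))) => //.
- by move=> w w' h; exact:
    (@sample_size_agree _ _ i eps alpha eps0 alpha0 alpha1 k k _ _ (leqnn k) h).
- by move=> v; case: ltnP; rewrite ler01 lexx.
- by move=> s; case: fresh => mc _; exact: (walk_law_tail sQ (mc k s)).
- move=> w; rewrite /D /= !mul1r /p_hat ler_pdivlMr; last first.
    by rewrite ltr0n sample_size_gt0.
  rewrite mulrC => /le_trans; apply; apply: ler_sum => s _.
  by rewrite truncatedE.
- move=> w _; rewrite ler_expR mul1r.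
  have h := @sample_size_large _ _ i eps alpha eps0 alpha0 alpha1 (run w) k k0.
  have L1 := log_term_ge1 alpha0 alpha1 k0.
  rewrite -/(N w) in h *; set n := (N w)%:R in h *.
  set p := fine _ in hp *.
  have n0 : 0 <= n by [].
  have p0 : 0 <= p by rewrite fine_ge0// avoid_prob_ge0.
  have e4 := expR1_le4 (R := R).
  have h1 : p * (expR 1 - 1) <= eps / 24 * 3.
    apply: (@le_trans _ _ (p * 3)); first by rewrite ler_wpM2l//; lra.
    by rewrite ler_wpM2r.
  have h2 : n * (p * (expR 1 - 1)) <= n * (eps / 24 * 3) by rewrite ler_wpM2l.
  have h3 : eps ^+ 2 * n <= eps * n by rewrite ler_wpM2r// expr2 ler_piMr// ltW.
  rewrite -mulrA; lra.
Qed.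

Let mu k := mean_return Q i (threshold k).

(** The new estimate is at most 2 mu_k <= 4 mu_(k-1), the preceding one at least mu_(k-1) / 6,
    whence 24. In the first iteration the length is at most 2. *)
Lemma accurate_T_hat_growth K w k : accurate Q i Z eps alpha K w -> (0 < k <= K)%N ->
  T_hat i eps alpha (run w) k <= 24 * last_mean i eps alpha (run w) k.
Proof.
move: eps0 eps1 => e0 e1 acc /andP[k0 kK].
have : T_hat i eps alpha (run w) k <= (1 + eps) * mu k.
  by have := acc k; rewrite k0 kK => /(_ isT) /andP[].
case: k k0 kK => // -[|k] _ kK hT; rewrite /last_mean /=.
  have /andP[_] := @T_hat_itv _ _ i eps alpha eps0 alpha0 alpha1 (run w) 1%N isT.
  by rewrite /threshold expn1; lra.
have /andP[h _] := acc k.+1 (ltnW kK).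
have h2 : mu k.+2 <= 2 * mu k.+1.
  by rewrite /mu /threshold (expnS 2 k.+1) mul2n -addnn mean_return_double.
have mu1 : 1 <= mu k.+1 by apply: (mean_return_ge1 i sQ); rewrite expn_gt0.
have mu2 : 1 <= mu k.+2 by apply: (mean_return_ge1 i sQ); rewrite expn_gt0.
have h3 : (1 + eps) * mu k.+2 <= 2 * mu k.+2.
  by rewrite ler_wpM2r ?(le_trans ler01)//; lra.
have h4 : 1 / 6 * mu k.+1 <= (1 - 5 / 6 * eps) * mu k.+1.
  by rewrite ler_wpM2r ?(le_trans ler01)//; lra.
have h5 : 1 / 6 * mu k.+1 <= T_hat i eps alpha (run w) k.+1 by exact: le_trans h4 h.
by move: (T_hat i eps alpha (run w) k.+1) h5 => x h5; lra.
Qed.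

(** Bound every logarithm by the last one; the powers of 2 sum to at most twice the last, so 290 = 2
    * 145. *)
Lemma accurate_steps K w : accurate Q i Z eps alpha K w ->
  \sum_(1 <= k < K.+1) steps i eps alpha (run w) k <=
  290 * (threshold K)%:R * log_term alpha K / eps ^+ 2.
Proof.
move=> acc.
have e2 : 0 < eps ^+ 2 by rewrite exprn_gt0.
pose c := 145 * log_term alpha K / eps ^+ 2.
apply: (@le_trans _ _ (\sum_(1 <= k < K.+1) (threshold k)%:R * c)).
  apply: ler_sum_nat => k /andP[k0 kK]; rewrite ltnS in kK.
  apply: (le_trans (steps_le eps0 eps1 alpha0 alpha1 k0 _)).
    by apply: (accurate_T_hat_growth acc); rewrite k0.
  have -> : 145 * (threshold k)%:R * log_term alpha k / eps ^+ 2 =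
    (threshold k)%:R * (145 * log_term alpha k / eps ^+ 2) by ring.
  rewrite ler_wpM2l// ler_wpM2r ?invr_ge0 ?(ltW e2)// ler_wpM2l//.
  rewrite ler_ln ?posrE ?divr_gt0 ?mulr_gt0 ?threshold_gt0//.
  by rewrite ler_pM2r ?invr_gt0// ler_pM2l// ler_nat leq_exp2l.
rewrite -mulr_suml.
have [->|K0] := posnP K.
  rewrite big_geq// mul0r /log_term /threshold expn0 mulr1.
  apply: divr_ge0 (ltW e2); apply: mulr_ge0 (ler0n _ _) _.
  rewrite ln_ge0// ler_pdivlMr// mul1r.
  by move: alpha1 => a1; lra.
have L1 := log_term_ge1 alpha0 alpha1 K0.
have -> : 290 * (threshold K)%:R * log_term alpha K / eps ^+ 2 = 2 * (threshold K)%:R * c.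
  by rewrite /c; ring.
rewrite ler_wpM2r//.
  apply: divr_ge0 (ltW e2); apply: mulr_ge0 (ler0n _ _) _.
  exact: le_trans L1.
rewrite -natrM -natr_sum ler_nat; elim: {c L1 K0 acc} K => [|K IH]; first by rewrite big_geq.
by rewrite big_nat_recr//= /threshold (expnS 2 K); move: IH; rewrite /threshold; lia.
Qed.

(** Failure lies in the union of inaccuracy, below alpha / 2, and the exceptional event [E], at most
    alpha / 8; this leaves a strict margin below alpha. *)
Lemma prob_stops_within (stop : (nat -> nat -> nat -> S) -> nat -> Prop) (K : nat)
    (E : set Omega) (bound : R) :
  (0 < K)%N -> measurable E -> fine (P E) <= alpha / 8 ->
  (forall k z z', (0 < k)%N -> agree i k.+1 (sample_cap eps alpha k) z z' -> stop z k -> stop z' k) ->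
  (forall w, accurate Q i Z eps alpha K w -> ~ E w -> stop (run w) K) ->
  290 * (threshold K)%:R * log_term alpha K / eps ^+ 2 <= bound ->
  ((1 - alpha)%:E < P [set w | stops_within i eps alpha (run w) (stop (run w)) bound])%E.
Proof.
move=> K0 mE PE stop_agree stopK hbound; set W := [set w | _].
have mW : measurable W.
  (* Measurability: a countable union over the stopping iteration k, each event being determined by
     the finitely many cells that iterations 1..k can read. *)
  pose Wk k := [set w | [/\ (1 <= k)%N, stop (run w) k,
    forall j, (1 <= j < k)%N -> ~ stop (run w) j &
    \sum_(1 <= j < k.+1) steps i eps alpha (run w) j <= bound]].
  rewrite (_ : W = \bigcup_k Wk k); last first.
    by apply/seteqP; split => [w [k]|w [k _]]; exists k.
  apply: bigcupT_measurable => k; apply: (measurable_run fresh (eps := eps) (alpha := alpha) (K := k)).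
  move=> w w' h [k0 st nst hs].
  have sub j : (j <= k)%N -> agree i j.+1 (sample_cap eps alpha j) (run w) (run w').
    move=> jk a s aj sM; apply: h; first exact: leq_trans aj _.
    apply: (leq_trans sM); apply/bigmax_leqP => b _.
    have bk : (b < k.+1)%N by apply: leq_trans (ltn_ord b) _.
    exact: (@leq_bigmax _ (fun b : 'I_k.+1 => nceil (budget eps alpha b)) (Ordinal bk)).
  have sub' j : (j <= k)%N -> agree i j.+1 (sample_cap eps alpha j) (run w') (run w).
    by move=> /sub hj a s aj sM; rewrite hj.
  split => //.
  - by apply: stop_agree st => //; exact: sub.
  - move=> j /andP[j0 jk] st'; apply: (nst j); first by rewrite j0.
    by apply: stop_agree st' => //; apply: sub'; exact: ltnW.
  - rewrite (_ : \sum_(1 <= j < k.+1) _ = \sum_(1 <= j < k.+1) steps i eps alpha (run w) j)//.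
    apply: eq_big_nat => j /andP[j0 jk]; symmetry.
    by apply: (@agree_steps _ _ i eps alpha eps0 alpha0 alpha1 j j) => //; exact: sub.
have mA : measurable [set w | ~ accurate Q i Z eps alpha K w].
  exact: measurableC (measurable_accurate fresh eps0 alpha0 alpha1 K).
have sub : ~` W `<=` [set w | ~ accurate Q i Z eps alpha K w] `|` E.
  move=> w nW; apply: contrapT => /not_orP[/contrapT acc nE]; apply: nW.
  apply: (stops_withinI K0 (stopK w acc nE)).
  exact: le_trans (accurate_steps acc) hbound.
have h1 : fine (P (~` W)) <= alpha / 2 * (1 - (threshold K)%:R^-1) + alpha / 8.
  apply: (le_trans (fine_prob_le P (measurableC mW) (measurableU _ _ mA mE) sub)).
  apply: le_trans (lerD (prob_inaccurate sQ fresh eps0 eps1 alpha0 alpha1 K) PE).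
  rewrite -fineD ?fin_num_measure//; apply: fine_le; rewrite ?fin_numD ?fin_num_measure//.
    exact: measurableU.
  exact: measureU2.
have h2 : fine (P (~` W)) = 1 - fine (P W).
  by rewrite probability_setC// fineB ?fin_num_measure.
rewrite -[P W]fineK ?fin_num_measure// lte_fin.
have th : 0 < (threshold K)%:R^-1 :> R by rewrite invr_gt0 threshold_gt0.
by move: alpha0 => a0; nra.
Qed.
End Stopping.

(** * The stopping threshold *)

Section Scale.
Context {R : realType}.
Implicit Types r eps alpha f : R.

Lemma sum_geometric_tail (a : nat -> R) (q : R) (n m : nat) : 0 < q < 1 ->
  (forall j, (n <= j)%N -> a j <= 4 * q ^+ j) -> (n <= m)%N ->
  \sum_(j < m) a j <= \sum_(j < n) a j + 4 * q ^+ n / (1 - q).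
Proof.
move=> /andP[q0 q1] ha /subnK <-; have p0 : 0 < 1 - q by rewrite subr_gt0.
set k := (m - n)%N.
apply: (@le_trans _ _ (\sum_(j < n) a j + 4 * (q ^+ n - q ^+ (k + n)) / (1 - q))).
  elim: k => [|k IH]; first by rewrite add0n subrr mulr0 mul0r addr0.
  rewrite addSn big_ord_recr /=.
  apply: (le_trans (lerD IH (ha _ (leq_addl k n)))).
  rewrite -addrA lerD2l le_eqVlt; apply/orP; left; apply/eqP.
  by rewrite exprS; field; rewrite gt_eqF.
rewrite lerD2l ler_wpM2r ?invr_ge0 ?(ltW p0)// ler_pM2l// gerBl.
by rewrite exprn_ge0// ltW.
Qed.

(* 2^(-1/r) *)
Definition decay r : R := expR (- (ln 2 / r)).

Lemma decay_gt0 r : 0 < decay r.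
Proof. exact: expR_gt0. Qed.

(** By ln 2 >= 1/2 and exp y >= 1 + y, [decay r] is at most 1 / (1 + 1 / (2 r)). This bounds the
    denominator of the geometric tail. *)
Lemma one_sub_decay r : 1 <= r -> 1 / (4 * r) <= 1 - decay r.
Proof.
move=> r1; have r0 : 0 < r by lra.
have y0 : 0 <= 1 / 2 / r by rewrite divr_ge0// ltW.
have h : decay r <= (1 + 1 / 2 / r)^-1.
  rewrite /decay expRN lef_pV2 ?posrE ?expR_gt0 ?addr_gt0 ?divr_gt0//.
  apply: le_trans (expR_ge1Dx _); rewrite lerD2l ler_wpM2r ?invr_ge0 ?(ltW r0)//.
  exact: ln2_ge_half.
have -> : 1 / (4 * r) = 1 - (1 - 1 / (4 * r)) by ring.
rewrite lerD2l lerN2; apply: (le_trans h).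
rewrite -[leLHS]mul1r ler_pdivrMr; last by rewrite addr_gt0// divr_gt0.
have -> : (1 - 1 / (4 * r)) * (1 + 1 / 2 / r) = 1 + (2 * r - 1) / (8 * r ^+ 2).
  by field; rewrite gt_eqF.
by rewrite lerDl divr_ge0 ?mulr_ge0 ?exprn_ge0 ?(ltW r0)//; lra.
Qed.

Lemma decay_lt1 r : 1 <= r -> decay r < 1.
Proof.
move=> r1; have h := one_sub_decay r1; have r0 : 0 < r by lra.
have : 0 < 1 / (4 * r) by rewrite divr_gt0// mulr_gt0.
by move: (1 / (4 * r)) h => x h; lra.
Qed.

Lemma powR2_decay (Ri : R) k : 0 < Ri -> 2 `^ (- (k%:R / Ri)) <= decay (Num.max 1 Ri) ^+ k.
Proof.
move=> Ri0; rewrite /decay -expRM_natr /powR pnatr_eq0 /= ler_expR !mulNr lerN2.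
have l2 : 0 <= ln 2 :> R by apply: le_trans (@ln2_ge_half R).
set M := Num.max 1 Ri; have hM : M^-1 <= Ri^-1.
  by rewrite lef_pV2 ?posrE// /M ?lt_max ?ltr01// le_max lexx orbT.
have -> : ln 2 / M * k%:R = ln 2 * k%:R * M^-1 by ring.
have -> : k%:R / Ri * ln 2 = ln 2 * k%:R * Ri^-1 by ring.
by rewrite ler_wpM2l// mulr_ge0.
Qed.

(** The truncation level at which both stopping rules are guaranteed. The logarithms are multiplied,
    not added, so that the bound splits into separate soft factors. *)
Definition scale r eps : R := 12 * r * (1 + ln r) * (1 + ln (1 / eps ^+ 2)).

Lemma inv_sqr_ge1 eps : 0 < eps < 1 -> 1 <= 1 / eps ^+ 2.
Proof.
move=> /andP[e0 e1]; rewrite ler_pdivlMr ?exprn_gt0// mul1r exprn_ile1// ltW//.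
Qed.

Lemma expR6_ge96 : 96 <= expR 6 :> R.
Proof.
have h := @expR_ge1Dx R (1 / 2).
have -> : 6 = 1 / 2 * 12%:R :> R by field.
rewrite expRM_natr; apply: (@le_trans _ _ ((3 / 2) ^+ 12)); first by rewrite !exprS expr0; lra.
by apply: lerXn2r; rewrite ?nnegrE ?expR_ge0//; lra.
Qed.

Lemma scale_ge1 r eps : 1 <= r -> 0 < eps < 1 -> 1 <= scale r eps.
Proof.
move=> r1 he; have a0 := ln_ge0 r1; have b0 := ln_ge0 (inv_sqr_ge1 he).
rewrite /scale; set a := ln r in a0 *; set b := ln _ in b0 *.
have h1 : 1 <= (1 + a) * (1 + b) by nra.
rewrite -mulrA; nra.
Qed.

(** Since ln 2 >= 1/2, the factor 12 leaves an exponent of at least 6 + ln r + ln (1 / eps): this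
    cancels r, yields eps, and exp 6 >= 96. The value 96 serves 16 r q <= eps / 6 and 4 q <= eps /
    24, with q the decay factor. *)
Lemma scale_decay r eps n : 1 <= r -> 0 < eps < 1 -> scale r eps <= n%:R ->
  96 * r * decay r ^+ n <= eps.
Proof.
move=> r1 he hn; have r0 : 0 < r by lra.
have a0 := ln_ge0 r1; have b0 := ln_ge0 (inv_sqr_ge1 he).
have [e0 e1] := andP he.
pose a := ln r; pose b := ln (1 / eps ^+ 2).
have h : decay r ^+ n <= expR (- (6 + a + b / 2)).
  rewrite /decay -expRM_natr ler_expR mulNr lerN2.
  apply: (@le_trans _ _ (6 * (1 + a) * (1 + b))).
    by rewrite -/a -/b in a0 b0 *; nra.
  apply: (@le_trans _ _ (1 / 2 / r * scale r eps)).
    rewrite /scale -/a -/b le_eqVlt; apply/orP; left; apply/eqP.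
    by field; rewrite gt_eqF.
  apply: ler_pM => //; first by rewrite divr_ge0// ltW.
    by have := scale_ge1 r1 he; lra.
  by rewrite ler_wpM2r ?invr_ge0 ?(ltW r0)//; exact: ln2_ge_half.
have hE : expR (- (6 + a + b / 2)) = (expR 6)^-1 * r^-1 * eps.
  have -> : - (6 + a + b / 2) = - 6 + - a + ln eps.
    rewrite /b div1r lnV ?posrE ?exprn_gt0// lnXn// -mulr_natr; lra.
  rewrite (expRD (- 6 + - a)) (expRD (- 6)) (expRN 6) (expRN a) (lnK e0).
  by rewrite /a (lnK r0).
rewrite hE in h; have e6 := expR6_ge96.
apply: (le_trans (ler_wpM2l _ h)); first by rewrite mulr_ge0// ltW.
have -> : 96 * r * ((expR 6)^-1 * r^-1 * eps) = 96 / expR 6 * eps.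
  by field; rewrite !gt_eqF// expR_gt0.
by rewrite ler_piMl ?(ltW e0)// ler_pdivrMr ?expR_gt0// mul1r.
Qed.

(** Expand the logarithm of 4 * 2 * [scale] / alpha, whose constant is 96 <= exp 6, using ln (1 + x)
    <= x; the term ln (1 / alpha) raises the factor 6 to 7. *)
Lemma scale_log r eps alpha t : 1 <= r -> 0 < eps < 1 -> 0 < alpha < 1 ->
  0 < t <= 2 * scale r eps ->
  ln (4 * t / alpha) <= 7 * (1 + ln r) * (1 + ln (1 / eps ^+ 2)) * Num.max 1 (ln (1 / alpha)).
Proof.
move=> r1 he /andP[al0 al1] /andP[t0 ht]; have r0 : 0 < r by lra.
have a0 := ln_ge0 r1; have F1 := inv_sqr_ge1 he; have b0 := ln_ge0 F1.
have c1 := expR6_ge96.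
pose a := ln r; pose b := ln (1 / eps ^+ 2); pose l := ln (1 / alpha).
have ia : 0 < alpha^-1 by rewrite invr_gt0.
have h : ln (4 * t / alpha) <= 6 + a + a + b + l.
  have a1 : 0 < 1 + a by rewrite /a; lra.
  have b1 : 0 < 1 + b by rewrite /b; lra.
  apply: (@le_trans _ _ (ln (96 * r * (1 + a) * (1 + b) * (1 / alpha)))).
    rewrite ler_ln ?posrE ?divr_gt0 ?mulr_gt0//.
    rewrite mul1r ler_pM2r ?invr_gt0//; move: ht; rewrite /scale -/a -/b.
    by move=> ht; lra.
  have lnMp (x y : R) : 0 < x -> 0 < y -> ln (x * y) = ln x + ln y by move=> ? ?; rewrite lnM.
  rewrite (lnMp (96 * r * (1 + a) * (1 + b))) ?mulr_gt0// (lnMp (96 * r * (1 + a))) ?mulr_gt0//.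
  rewrite (lnMp (96 * r)) ?mulr_gt0// (lnMp 96)// -/l -/a.
  have la : ln (1 + a) <= a by apply: le_ln1Dx; lra.
  have lb : ln (1 + b) <= b by apply: le_ln1Dx; lra.
  have l96 : ln 96 <= 6 :> R by rewrite -[leRHS](@expRK R) ler_ln ?posrE ?expR_gt0.
  by lra.
apply: (le_trans h); rewrite -/a -/b -/l.
have m1 : 1 <= Num.max 1 l by rewrite le_max lexx.
have ml : l <= Num.max 1 l by rewrite le_max lexx orbT.
move: (Num.max 1 l) m1 ml => m m1 ml; rewrite -/a -/b in a0 b0 *.
have h1 : 6 + a + a + b <= 6 * ((1 + a) * (1 + b)) by nra.
have h2 : 1 <= (1 + a) * (1 + b) by nra.
rewrite -[7 * (1 + a) * (1 + b)]mulrA.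
move: ((1 + a) * (1 + b)) h1 h2 => x h1 h2.
have h3 : 6 * x + m <= 6 * x * m + x * m by nra.
by apply: le_trans (_ : 6 * x + m <= _); [lra|apply: (le_trans h3); rewrite -mulrDl; nra].
Qed.
End Scale.

Section SoftBound.
Context {R : realType}.

Lemma soft_ge_max q (f : R) : Num.max 1 f <= soft q f.
Proof.
have m1 : 1 <= Num.max 1 f by rewrite le_max lexx.
rewrite /soft ler_peMr ?(le_trans ler01)// exprn_ege1// lerDl ln_ge0//.
Qed.

Lemma soft_ge1 q (f : R) : 1 <= soft q f.
Proof. by apply: le_trans (soft_ge_max q f); rewrite le_max lexx. Qed.

(** One power of each of 1 + ln r and 1 + ln (1 / eps^2) comes from [scale] and a second from the
    logarithm, hence the exponent 2; the constant 24 is 2 * 12. *)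
Lemma scale_soft (c Ri eps alpha t : R) : 0 <= c -> 0 < eps < 1 -> 0 < alpha < 1 ->
  0 < t <= 2 * scale (Num.max 1 Ri) eps ->
  c * t * ln (4 * t / alpha) / eps ^+ 2 <=
  c * (7 * 24) * (soft 2%N Ri * soft 2%N (ln (1 / alpha)) * soft 2%N (1 / eps ^+ 2)).
Proof.
move=> c0 he hal ht; have F1 := inv_sqr_ge1 he; have [e0 e1] := andP he.
set r := Num.max 1 Ri in ht *; have r1 : 1 <= r by rewrite le_max lexx.
have a0 := ln_ge0 r1; have b0 := ln_ge0 F1.
have hL := scale_log r1 he hal ht.
set m := Num.max 1 (ln (1 / alpha)) in hL; have m1 : 1 <= m by rewrite le_max lexx.
have m0 : 0 <= m by exact: le_trans m1.
have r0 : 0 <= r by exact: le_trans r1.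
have [t0 t2] := andP ht.
have sr : soft 2%N Ri = r * (1 + ln r) ^+ 2 by [].
have sF : soft 2%N (1 / eps ^+ 2) = 1 / eps ^+ 2 * (1 + ln (1 / eps ^+ 2)) ^+ 2.
  by rewrite /soft (max_idPr F1).
have e20 : 0 <= (eps ^+ 2)^-1 by rewrite invr_ge0 exprn_ge0// ltW.
rewrite sr sF; pose a := 1 + ln r; pose b := 1 + ln (1 / eps ^+ 2).
have a1 : 0 <= a by rewrite addr_ge0.
have b1 : 0 <= b by rewrite addr_ge0.
apply: (@le_trans _ _ (c * (2 * (12 * r * a * b)) * (7 * a * b * m) / eps ^+ 2)).
  rewrite ler_wpM2r//; apply: le_trans (_ : c * t * (7 * a * b * m) <= _).
    by rewrite ler_wpM2l// mulr_ge0// ltW.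
  by rewrite ler_wpM2r ?mulr_ge0// ler_wpM2l.
have -> : c * (2 * (12 * r * a * b)) * (7 * a * b * m) / eps ^+ 2 =
    c * (7 * 24) * (r * a ^+ 2 * m * (1 / eps ^+ 2 * b ^+ 2)) by ring.
rewrite ler_wpM2l ?mulr_ge0// ler_wpM2r//; first by rewrite div1r mulr_ge0// exprn_ge0.
rewrite ler_wpM2l//; first by rewrite mulr_ge0// exprn_ge0.
exact: soft_ge_max.
Qed.

(** Take the least positive k reaching A: by minimality the preceding power of 2 is below A, and if
    k = 1 then 2 <= 2 A. *)
Lemma threshold_between (A : R) : 1 <= A ->
  exists k, (0 < k)%N /\ A <= (threshold k)%:R <= 2 * A.
Proof.
move=> A1; have ex : exists k, A <= (threshold k.+1)%:R.
  exists (Num.truncn A); apply: ltW; apply: (lt_le_trans (Num.Theory.truncnS_gt A)).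
  by rewrite ler_nat /threshold ltnW// ltn_expl.
exists (ex_minn ex).+1; split => //; case: ex_minnP => -[|k] -> //= min.
  by rewrite /threshold expn1; lra.
have : ~~ (A <= (threshold k.+1)%:R) by apply/negP => /min; rewrite ltnn.
by rewrite -ltNge /threshold (expnS _ k.+1) natrM => /ltW h; rewrite ler_pM2l.
Qed.
End SoftBound.

(** * Consequences of the exponential return tail *)

Section ReturnTail.
Context {R : realType} {S : countType} (Q : S -> S -> R) (i : S).
Context {d : measure_display} {Omega : measurableType d}.
Context (Pr : S -> probability Omega R) (X : nat -> Omega -> S).
Hypothesis mf : markov_family Pr Q X.

Let sQ : stochastic Q. Proof. by case: mf. Qed.

Lemma prob_return_time k :
  Pr i [set w | ((k%:R)%:E < return_time i (X ^~ w) :> \bar R)%E] = avoid_prob Q i k i.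
Proof.
case: mf => _ /(_ i) mc; rewrite -(prob_walk_length sQ mc (ltnSn k)).
congr (Pr i _); apply/seteqP; split => w /=; rewrite ltn_walk_length// ltnSn /=.
  by move/lt_return_time.
by move=> h; apply/lt_return_time.
Qed.

(** Irreducibility gives a path of positive probability from i to x, and recurrence is carried along
    it; a path of length 0 forces x = i. *)
Lemma irreducible_recurs : irreducible Pr X -> recurs Q i i -> forall x, recurs Q i x.
Proof.
move=> irr ri x; have [n] := irr i x; case: mf => _ /(_ i) mc.
have mX t y : measurable [set w | X t w = y] by case: mc.
case: n => [|n] h.
  suff -> : x = i by [].
  apply: contrapT => /eqP xi; move: h; rewrite ltNge; apply/negP/negPn.
  case: mc => _ P0 _; have <- : Pr i (~` [set w | X 0%N w = i]) = 0%E.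
    by rewrite probability_setC// P0 subee.
  apply: le_measure; rewrite ?inE//; first exact: measurableC.
  by move=> w /= -> ; exact/eqP.
apply: (@recurs_reachable _ _ Q i sQ n i x ri ri).
rewrite -(prob_pass sQ mc); apply: (lt_le_trans h); apply: le_measure; rewrite ?inE//.
  exact: (@measurable_passing _ _ Q _ _ _ _ _ mc).
move=> w /= Xw j; rewrite size_rcons size_nseq ltnS leq_eqVlt => /orP[/eqP ->|jn].
  by rewrite nth_rcons size_nseq ltnn eqxx.
by rewrite nth_rcons size_nseq jn nth_nseq jn.
Qed.

Context (Ri : R).
Hypothesis Ri0 : 0 < Ri.
Hypothesis tail : forall k : nat, (1 <= k)%N ->
  (Pr i [set w | (k%:R)%:E < return_time i (X ^~ w) :> \bar R]
   <= (4 * 2 `^ (- (k%:R / Ri)))%:E)%E.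

Let r := Num.max 1 Ri.

Lemma avoid_prob_decay k : (0 < k)%N -> fine (avoid_prob Q i k i) <= 4 * decay r ^+ k.
Proof.
move=> k0; have := tail k0; rewrite prob_return_time.
rewrite -{1}[avoid_prob Q i k i]fineK ?avoid_prob_fin// lee_fin => /le_trans; apply.
by rewrite ler_pM2l// powR2_decay.
Qed.

(** The terms from n on are dominated by a geometric series with sum 4 q^n / (1 - q), where 1 / (1 -
    q) <= 4 r. *)
Lemma mean_return_tail n m : (0 < n)%N -> (n <= m)%N ->
  mean_return Q i m <= mean_return Q i n + 16 * r * decay r ^+ n.
Proof.
move=> n0 nm; have r1 : 1 <= r by rewrite le_max lexx.
have q1 := decay_lt1 r1; have q0 := decay_gt0 r.
have hq : 0 < decay r < 1 by rewrite q0.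
have ha j : (n <= j)%N -> fine (avoid_prob Q i j i) <= 4 * decay r ^+ j.
  by move=> nj; apply: avoid_prob_decay; exact: leq_trans nj.
apply: (le_trans (sum_geometric_tail hq ha nm)).
have rp : 0 < r by exact: lt_le_trans r1.
rewrite lerD2l ler_pdivrMr ?subr_gt0//.
have h := one_sub_decay r1.
have h2 : 16 * r * decay r ^+ n * (1 / (4 * r)) = 4 * decay r ^+ n by field; rewrite gt_eqF.
by rewrite -h2 ler_wpM2l// !mulr_ge0// ?exprn_ge0// ltW.
Qed.

Lemma tail_recurs : recurs Q i i.
Proof.
apply: (@recurs_self _ _ Q i sQ (mean_return Q i 1 + 16 * r * decay r ^+ 1)) => n.
have [->|n0] := posnP n; last exact: mean_return_tail.
apply: le_trans (mean_return_tail (ltnSn 0) (leqnn 1)).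
exact: le_mean_return.
Qed.
End ReturnTail.

(** * Both stopping rules at one common iteration *)

Theorem theorem13 (R : realType) (K0 : R) (hK0 : 0 < K0) :
  exists (C : R) (q : nat), 0 < C /\
  forall (S : countType) (Q : S -> S -> R) (pi : S -> R)
    (d : measure_display) (Omega : measurableType d)
    (Pr : S -> probability Omega R) (X : nat -> Omega -> S)
    (V : S -> R) (numax gamma b : R),
  markov_family Pr Q X ->
  positive_recurrent Pr X ->
  unique_stationary Q pi ->
  lyapunov Pr Q X V numax gamma b ->
  let B := sublevel V b in
  forall eps alpha Delta : R,
  0 < eps < 1 -> 0 < alpha < 1 -> 0 < Delta < 1 ->
  forall (i : S) (Ri : R), B i ->
  return_tail_constant Pr X B numax gamma K0 i Ri ->
  forall (d' : measure_display) (Omega' : measurableType d')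
    (P : probability Omega' R) (Z : nat -> nat -> nat -> Omega' -> S),
  fresh_realizations P Q i Z ->
  let run (w : Omega') := fun k s t => Z k s t w in
  (pi i < (1 - eps) * Delta / (1 + eps) ->
     ((1 - alpha)%:E <
      P [set w | stops_within i eps alpha (run w)
           (fun k => (pi_hat i eps alpha (run w) k < Delta / (1 + eps))%R)
           (C * (soft q Ri * soft q (ln (1 / alpha)) * soft q (1 / eps ^+ 2)
                 * soft q (ln (pi i * Ri * (1 - pi i / Delta)^-1))))%R])%E) /\
  ((1 - alpha)%:E <
     P [set w | stops_within i eps alpha (run w)
          (fun k => (p_hat i eps alpha (run w) k < 2 * eps / 3)%R)
          (C * (soft q Ri * soft q (ln (1 / alpha)) * soft q (1 / eps ^+ 2)))%R])%E.
Proof.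
have C0 : 0 < 290 * (7 * 24) :> R by apply: mulr_gt0; [rewrite ltr0n|apply: mulr_gt0].
exists (290 * (7 * 24)), 2%N; split; first exact: C0.
move=> S Q pi d Omega Pr X V numax gamma b mf _ [st _].
move=> [[irr _ _ _ _] _ _ _] B eps alpha Delta he hal hDelta i Ri _ [Ri0 tail _].
move=> d' Omega' P Z fresh run.
have sQ : stochastic Q by case: mf.
have [e0 e1] := andP he; have [al0 al1] := andP hal; have [D0 D1] := andP hDelta.
set r := Num.max 1 Ri; have r1 : 1 <= r by rewrite le_max lexx.
(* This K depends only on r and eps and serves both parts; its threshold exceeds the scale by at
   most a factor 2, which controls the cost. *)
have [K [Kpos /andP[AK KA]]] := threshold_between (scale_ge1 r1 he).
have hdec := scale_decay r1 he AK.
have bound : 290 * (threshold K)%:R * log_term alpha K / eps ^+ 2 <=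
    (290 * (7 * 24)) * (soft 2%N Ri * soft 2%N (ln (1 / alpha)) * soft 2%N (1 / eps ^+ 2)).
  by apply: scale_soft; rewrite ?threshold_gt0.
have q0 : 0 <= decay r ^+ threshold K by rewrite exprn_ge0// ltW// decay_gt0.
have tK : (0 < threshold K)%N by rewrite expn_gt0.
have a8 : 0 <= alpha / 8 by rewrite divr_ge0// ltW.
split; last first.
  apply: (@prob_stops_within _ _ Q i _ _ P Z sQ fresh eps alpha e0 e1 al0 al1
    (fun z k => p_hat i eps alpha z k < 2 * eps / 3) K
    [set w | 2 * eps / 3 <= p_hat i eps alpha (run w) K]) => //.
  - apply: (measurable_run fresh (eps := eps) (alpha := alpha) (K := K)) => w w' h /=.
    by rewrite (@agree_p_hat _ _ i eps alpha e0 al0 al1 K K _ _ Kpos (leqnn K) h).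
  - apply: (prob_p_hat_large sQ fresh e0 e1 al0 al1 Kpos).
    apply: (le_trans (avoid_prob_decay mf Ri0 tail tK)).
    rewrite -/r; have : decay r ^+ threshold K <= r * decay r ^+ threshold K by rewrite ler_peMl.
    by rewrite -mulrA in hdec; lra.
  - move=> k z z' k0 h.
    by rewrite (@agree_p_hat _ _ i eps alpha e0 al0 al1 k k _ _ k0 (leqnn k) h).
  - by move=> w _ /negP; rewrite -ltNge.
move=> hpi; have pi0 : 0 <= pi i by case: st.
(* The exceptional event is empty here: accuracy up to iteration K already forces the stopping rule
   at K. *)
apply: (@prob_stops_within _ _ Q i _ _ P Z sQ fresh eps alpha e0 e1 al0 al1
    (fun z k => pi_hat i eps alpha z k < Delta / (1 + eps)) K set0) => //.
- by rewrite measure0.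
- move=> k z z' k0 h; rewrite /pi_hat.
  by rewrite (@agree_T_hat _ _ i eps alpha e0 al0 al1 k k _ _ k0 (leqnn k) h).
- move=> w acc _; have /andP[lowT _] := acc K (introT andP (conj Kpos (leqnn K))).
  have rec := irreducible_recurs mf irr (tail_recurs mf Ri0 tail).
  have kac := @kac_lower_bound _ _ Q i sQ pi st _ _ rec (fun m => mean_return_tail mf Ri0 tail tK).
  have pi1 : pi i <= 1.
    have := @mean_return_le _ _ Q i sQ pi st 1; rewrite /mean_return big_ord_recl big_ord0 /=.
    by rewrite addr0 mulr1.
  have /andP[T1 _] := T_hat_itv i e0 al0 al1 (run w) Kpos.
  rewrite -/(run w) in lowT; rewrite /pi_hat.
  move: (T_hat _ _ _ _ _) lowT T1 => T lowT T1.
  set mu := mean_return _ _ _ in lowT kac.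
  rewrite -/r in kac.
  (* The truncation bias: 96 r q <= eps divided by 6, with pi_i <= 1. *)
  have hc : pi i * (16 * r * decay r ^+ threshold K) <= eps / 6.
    apply: (@le_trans _ _ (16 * r * decay r ^+ threshold K)); last by lra.
    by rewrite ler_piMl// !mulr_ge0//; lra.
  have pimu : 1 - eps / 6 <= pi i * mu by rewrite mulrDr in kac; lra.
  have piT : 1 - eps <= pi i * T.
    apply: le_trans (ler_wpM2l pi0 lowT); rewrite mulrCA.
    (* The product equals 1 - eps + 5 eps^2 / 36: the sampling error 5 eps / 6 and the bias eps / 6
       together spend exactly eps to first order. *)
    apply: (@le_trans _ _ ((1 - 5 / 6 * eps) * (1 - eps / 6))); first by nra.
    by rewrite ler_wpM2l//; lra.
  have T0 : 0 < T by lra.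
  rewrite ltr_pdivrMr// mulrC.
  have ep : 0 < 1 - eps by lra.
  have h : pi i * T < (1 - eps) * Delta / (1 + eps) * T by rewrite ltr_pM2r.
  rewrite -(ltr_pM2l ep) mulr1; apply: (le_lt_trans piT); apply: (lt_le_trans h).
  by rewrite le_eqVlt; apply/orP; left; apply/eqP; ring.
- have soft_ge0 f : 0 <= soft 2%N f := le_trans ler01 (soft_ge1 2 f).
  (* The logarithmic soft factor of part (a) is at least 1, so inserting it only enlarges the
     bound. *)
  apply: (le_trans bound); rewrite ler_pM2l; last exact: C0.
  by rewrite ler_peMr ?soft_ge1//; apply: mulr_ge0; [apply: mulr_ge0|]; exact: soft_ge0.
Qed.
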